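(* Let $\bar\sigma\in\Sigma$. There exists a constant $c_{\mathbb{E}}>0$ independent of $N$ such that for all $t\in[0,T]$ $$\|\widehat{x}_{\mathbb{E}}(t)-\widehat{x}_{\bar\sigma}(t)\|_{P_{\bar\sigma}(t)}\le c_{\mathbb{E}}\;\mathbb{E}\big[\|\mathcal{S}_\sigma-\mathcal{S}_{\bar\sigma}\|_1\big].$$
   Context: Let $T>0$, $n,m,r\in\mathbb{N}$, $B\in\mathbb{R}^{n,m}$, $C\in\mathbb{R}^{r,n}$, $x_0\in\mathbb{R}^n$ and $y\in L^2(0,T;\mathbb{R}^r)$. $\|\cdot\|$ is the Euclidean norm on vectors and the induced norm on matrices; for a symmetric positive definite matrix $M$ set $\|z\|_M^2=z^\top M z$. Uncertain parameters: $\Sigma_A,\Sigma_\Gamma,\Sigma_R,\Sigma_Q$ are nonempty finite subsets of Euclidean spaces, $\Sigma=\Sigma_A\times\Sigma_\Gamma\times\Sigma_R\times\Sigma_Q=\{\sigma_1,\dots,\sigma_N\}$ has $N$ elements and carries the uniform probability measure, so $\mathbb{E}[f(\sigma)]=\frac1N\sum_{k=1}^N f(\sigma_k)$. Each $\sigma=(\sigma_A,\sigma_\Gamma,\sigma_R,\sigma_Q)\in\Sigma$ determines a matrix $A_\sigma\in\mathbb{R}^{n,n}$ (depending only on $\sigma_A$) and symmetric positive definite matrices $\Gamma_\sigma\in\mathbb{R}^{n,n}$ (depending only on $\sigma_\Gamma$), $R_\sigma\in\mathbb{R}^{m,m}$ (depending only on $\sigma_R$), $Q_\sigma\in\mathbb{R}^{r,r}$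 (depending only on $\sigma_Q$). For a quadruple of matrices write $\mathcal{S}_\sigma=(A_\sigma,\Gamma_\sigma,R_\sigma,Q_\sigma)$; differences are componentwise and $\|(A,\Gamma,R,Q)\|_1=\|A\|+\|\Gamma\|+\|R\|+\|Q\|$. For $\bar\sigma\in\Sigma$, $\Pi_{\bar\sigma}$ and $\widehat{x}_{\bar\sigma}$ are the unique solutions on $[0,T]$ of $$\dot\Pi_{\bar\sigma}=A_{\bar\sigma}\Pi_{\bar\sigma}+\Pi_{\bar\sigma}A_{\bar\sigma}^\top-\Pi_{\bar\sigma}C^\top Q_{\bar\sigma}^{-1}C\Pi_{\bar\sigma}+BR_{\bar\sigma}B^\top,\quad\Pi_{\bar\sigma}(0)=\Gamma_{\bar\sigma},$$ $$\dot{\widehat{x}}_{\bar\sigma}=A_{\bar\sigma}\widehat{x}_{\bar\sigma}+\Pi_{\bar\sigma}C^\top Q_{\bar\sigma}^{-1}(y-C\widehat{x}_{\bar\sigma}),\quad\widehat{x}_{\bar\sigma}(0)=x_0,$$ and $P_{\bar\sigma}(t)=\Pi_{\bar\sigma}^{-1}(t)$. With $A_{\mathbb{E}}=\mathbb{E}[A_\sigma]$, $\Gamma_{\mathbb{E}}=\mathbb{E}[\Gamma_\sigma]$, $R_{\mathbb{E}}=\mathbb{E}[R_\sigma]$, $Q_{\mathbb{E}}=\mathbb{E}[Q_\sigma]$, the functions $\Pi_{\mathbb{E}}$ and $\widehat{x}_{\mathbb{E}}$ are the unique solutions on $[0,T]$ of $$\dot\Pi_{\mathbb{E}}=A_{\mathbb{E}}\Pi_{\mathbb{E}}+\Pi_{\mathbb{E}}A_{\mathbb{E}}^\top-\Pi_{\mathbb{E}}C^\top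 Q_{\mathbb{E}}^{-1}C\Pi_{\mathbb{E}}+BR_{\mathbb{E}}B^\top,\quad\Pi_{\mathbb{E}}(0)=\Gamma_{\mathbb{E}},$$ $$\dot{\widehat{x}}_{\mathbb{E}}=A_{\mathbb{E}}\widehat{x}_{\mathbb{E}}+\Pi_{\mathbb{E}}C^\top Q_{\mathbb{E}}^{-1}(y-C\widehat{x}_{\mathbb{E}}),\quad\widehat{x}_{\mathbb{E}}(0)=x_0.$$ ''Independent of $N$'' means that the constant does not depend on the number $N$ of parameters; it may depend on $T,B,C,x_0,y$ and on the matrices involved. *)

(* Defs.v *)
From HB Require Import structures.
From mathcomp Require Import all_boot all_order all_algebra finmap.
From mathcomp Require Import all_classical all_reals all_analysis.

Set Implicit Arguments.
Unset Strict Implicit.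
Unset Printing Implicit Defensive.

Import Order.TTheory GRing.Theory Num.Theory.
Import numFieldNormedType.Exports.

Local Open Scope classical_set_scope.
Local Open Scope ring_scope.

(** The norm [`|x|] that the library puts on matrices is the max norm, hence
    the separate Euclidean and induced norms below. *)

Definition enorm (R : realType) (n : nat) (v : 'cV[R]_n) : R :=
  Num.sqrt (\sum_(i < n) v i 0 ^+ 2).

Definition opnorm (R : realType) (m n : nat) (M : 'M[R]_(m, n)) : R :=
  sup [set enorm (M *m v) | v in [set v : 'cV[R]_n | enorm v <= 1]].

Definition posdef (R : realType) (n : nat) (M : 'M[R]_n) : Prop :=
  M^T = M /\ forall v : 'cV[R]_n, v != 0 -> 0 < (v^T *m M *m v) 0 0.

Definition wnorm (R : realType) (n : nat) (M : 'M[R]_n) (z : 'cV[R]_n) : R :=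
  Num.sqrt ((z^T *m M *m z) 0 0).

(** Quadruples [(A, Gamma, R, Q)], where [R] is the [m * m] matrix; addition
    and subtraction are those of the library product, hence componentwise. *)
Notation quad R n m r :=
  ('M[R]_n * 'M[R]_n * 'M[R]_m * 'M[R]_r)%type (only parsing).

Section Quad.
Context {R : realType} {n m r : nat}.
Implicit Type S : quad R n m r.

Definition drift S : 'M[R]_n := S.1.1.1.
Definition init_cov S : 'M[R]_n := S.1.1.2.
Definition model_cov S : 'M[R]_m := S.1.2.
Definition obs_cov S : 'M[R]_r := S.2.

Definition admissible S : Prop :=
  [/\ posdef (init_cov S), posdef (model_cov S) & posdef (obs_cov S)].

Definition quad_norm1 S : R :=
  opnorm (drift S) + opnorm (init_cov S) + opnorm (model_cov S)
  + opnorm (obs_cov S).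

(** The matrices of [S], and the inverses of the positive definite ones, have
    induced norm at most [kappa]. *)
Definition quad_bounded (kappa : R) S : Prop :=
  [/\ opnorm (drift S) <= kappa,
      opnorm (init_cov S) <= kappa /\ opnorm (invmx (init_cov S)) <= kappa,
      opnorm (model_cov S) <= kappa /\ opnorm (invmx (model_cov S)) <= kappa
    & opnorm (obs_cov S) <= kappa /\ opnorm (invmx (obs_cov S)) <= kappa].

End Quad.

Definition expect (R : realType) (I : finType) (V : lmodType R) (f : I -> V) : V :=
  #|I|%:R^-1 *: \sum_(i : I) f i.

Definition expect_quad (R : realType) (n m r : nat) (I : finType)
    (S : I -> quad R n m r) : quad R n m r :=
  (expect (fun i => drift (S i)), expect (fun i => init_cov (S i)),
   expect (fun i => model_cov (S i)), expect (fun i => obs_cov (S i))).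

(** Each matrix depends only on its own component of the parameter. *)
Definition param_quad (R : realType) (n m r : nat) (SA SG SR SQ : Type)
    (A : SA -> 'M[R]_n) (G : SG -> 'M[R]_n) (W : SR -> 'M[R]_m)
    (Q : SQ -> 'M[R]_r) (s : SA * SG * SR * SQ) : quad R n m r :=
  (A s.1.1.1, G s.1.1.2, W s.1.2, Q s.2).

Definition square_integrable (R : realType) (T : R) (r : nat)
    (y : R -> 'cV[R]_r) : Prop :=
  (forall i, measurable_fun `[0, T] (fun t => y t i 0)) /\
  (\int[@lebesgue_measure R]_(t in `[0%R, T]) (enorm (y t) ^+ 2)%:E < +oo)%E.

(** Classical solution on [[0, T]]. Continuity on the closed interval and the
    equation in its interior give the one-sided derivatives at 0 and T. *)
Definition riccati_solution (R : realType) (T : R) (n m r : nat)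
    (B : 'M[R]_(n, m)) (C : 'M[R]_(r, n)) (S : quad R n m r)
    (P : R -> 'M[R]_n) : Prop :=
  [/\ P 0 = init_cov S,
      {within `[0, T], continuous P}
    & forall t, 0 < t < T ->
        is_derive t 1 P
          (drift S *m P t + P t *m (drift S)^T
           - P t *m C^T *m invmx (obs_cov S) *m C *m P t
           + B *m model_cov S *m B^T)].

Definition filter_rhs (R : realType) (n m r : nat) (C : 'M[R]_(r, n))
    (S : quad R n m r) (P : 'M[R]_n) (y : 'cV[R]_r) (x : 'cV[R]_n) : 'cV[R]_n :=
  drift S *m x + P *m C^T *m invmx (obs_cov S) *m (y - C *m x).

(** Since [y] is only square integrable, the equation is understood in the
    sense of Caratheodory, that is, in integrated form. *)
Definition filter_solution (R : realType) (T : R) (n m r : nat)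
    (C : 'M[R]_(r, n)) (x0 : 'cV[R]_n) (y : R -> 'cV[R]_r) (S : quad R n m r)
    (P : R -> 'M[R]_n) (x : R -> 'cV[R]_n) : Prop :=
  {within `[0, T], continuous x} /\
  forall t, 0 <= t <= T -> forall i,
    x t i 0 = x0 i 0
      + \int[@lebesgue_measure R]_(s in `[0, t])
          (filter_rhs C S (P s) (y s) (x s)) i 0.

(* Main.v *)
Require Import Defs.
From HB Require Import structures.
From mathcomp Require Import all_boot all_order all_algebra finmap.
From mathcomp Require Import all_classical all_reals all_analysis.
From mathcomp Require Import measurable_realfun ring lra.
Set Implicit Arguments.
Unset Strict Implicit.
Unset Printing Implicit Defensive.
Import Order.TTheory GRing.Theory Num.Theory.
Import numFieldNormedType.Exports.
Local Open Scope classical_set_scope.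
Local Open Scope ring_scope.

(** Let [e] be the mean distance of the uncertain quadruples to the nominal
    one. By Jensen's inequality the averaged quadruple is within a multiple of
    [e] of the nominal one, so everything reduces to a Lipschitz estimate for
    the map sending the data [(A, Gamma, R, Q)] to the filter, with a constant
    that is uniform over all data bounded by a common constant. Distances are
    measured in the entrywise l1 norm, which is submultiplicative and, in fixed
    dimensions, equivalent to the induced norm.

    The averaged quadruple is itself bounded. Only the inverse of the mean of
    the [Q] needs an argument: a bound on an inverse amounts to coercivity of
    the quadratic form, by Cauchy-Schwarz, and coercivity passes to means
    ([l1norm_invmx_expect]).

    The Riccati equation is quadratic, so the core is a bound on its solution
    [P] by the data alone. Here positivity enters. [P] is symmetric, and it is
    positive semidefinite because the equation can be written
    [P' = F P + P F^T + W] with [W] positive semidefinite ([psd_invariant],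
    [riccati_coercive]). Then the quadratic term can only lower the trace, and
    the trace controls a positive semidefinite matrix, so Gronwall's inequality
    applies ([riccati_le]). Once two solutions are bounded, their difference
    satisfies a linear differential inequality with defect of order [e], and
    Gronwall's inequality gives a difference of order [e] ([riccati_close]).

    The filter equation is linear in the state. Subtracting two integrated
    equations gives an integral Gronwall inequality; the observation [y] enters
    its defect only through the integral of [1 + |y|^2] ([filter_close]).
    Finally, [Pi0] is bounded below by a positive multiple of the identity,
    again by [riccati_coercive], so its inverse is bounded, and the norm it
    weights is dominated by the l1 norm. *)

(** * Entrywise norms of matrices *)

Definition l1norm (R : realType) (m n : nat) (M : 'M[R]_(m, n)) : R :=
  \sum_(i < m) \sum_(j < n) `|M i j|.

Section L1Norm.
Context {R : realType}.

Lemma l1norm_ge0 m n (M : 'M[R]_(m, n)) : 0 <= l1norm M.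
Proof. by apply: sumr_ge0 => i _; apply: sumr_ge0 => j _. Qed.

Lemma l1norm0 m n : l1norm (0 : 'M[R]_(m, n)) = 0.
Proof.
by rewrite /l1norm big1// => i _; rewrite big1// => j _; rewrite mxE normr0.
Qed.

Lemma entry_le_l1norm m n (M : 'M[R]_(m, n)) i j : `|M i j| <= l1norm M.
Proof.
rewrite /l1norm (bigD1 i)//= (bigD1 j)//= -addrA lerDl addr_ge0//.
  by apply: sumr_ge0.
by apply: sumr_ge0 => k _; apply: sumr_ge0.
Qed.

Lemma l1norm_le_entries m n (M : 'M[R]_(m, n)) c :
  (forall i j, `|M i j| <= c) -> l1norm M <= (m * n)%:R * c.
Proof.
move=> h; rewrite /l1norm.
have -> : (m * n)%:R * c = \sum_(i < m) \sum_(j < n) c.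
  by rewrite !sumr_const !card_ord -mulrnA mulnC mulr_natl.
by apply: ler_sum => i _; apply: ler_sum => j _.
Qed.

Lemma l1normN m n (M : 'M[R]_(m, n)) : l1norm (- M) = l1norm M.
Proof. by apply: eq_bigr => i _; apply: eq_bigr => j _; rewrite mxE normrN. Qed.

Lemma l1normZ m n a (M : 'M[R]_(m, n)) : l1norm (a *: M) = `|a| * l1norm M.
Proof.
rewrite /l1norm mulr_sumr; apply: eq_bigr => i _; rewrite mulr_sumr.
by apply: eq_bigr => j _; rewrite mxE normrM.
Qed.

Lemma ler_l1normD m n (M N : 'M[R]_(m, n)) :
  l1norm (M + N) <= l1norm M + l1norm N.
Proof.
rewrite /l1norm -big_split; apply: ler_sum => i _ /=.
by rewrite -big_split; apply: ler_sum => j _ /=; rewrite mxE ler_normD.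
Qed.

Lemma ler_l1normB m n (M N : 'M[R]_(m, n)) :
  l1norm (M - N) <= l1norm M + l1norm N.
Proof. by rewrite -(l1normN N) ler_l1normD. Qed.

Lemma l1norm_tr m n (M : 'M[R]_(m, n)) : l1norm M^T = l1norm M.
Proof.
rewrite /l1norm exchange_big; apply: eq_bigr => i _; apply: eq_bigr => j _.
by rewrite mxE.
Qed.

Lemma ler_l1normM m n p (M : 'M[R]_(m, n)) (N : 'M[R]_(n, p)) :
  l1norm (M *m N) <= l1norm M * l1norm N.
Proof.
rewrite /l1norm mulr_suml; apply: ler_sum => i _.
apply: (@le_trans _ _ (\sum_(j < p) \sum_(k < n) `|M i k| * `|N k j|)).
  apply: ler_sum => j _; rewrite mxE; apply: le_trans (ler_norm_sum _ _ _) _.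
  by apply: ler_sum => k _; rewrite normrM.
rewrite exchange_big mulr_suml; apply: ler_sum => k _ /=.
rewrite -mulr_sumr ler_wpM2l// (bigD1 k)//= lerDl.
by apply: sumr_ge0 => l _; apply: sumr_ge0.
Qed.

Lemma l1normM_le m n p (M : 'M[R]_(m, n)) (N : 'M[R]_(n, p)) a b :
  l1norm M <= a -> l1norm N <= b -> l1norm (M *m N) <= a * b.
Proof.
move=> Ma Nb; apply: le_trans (ler_l1normM _ _) _.
by rewrite ler_pM// l1norm_ge0.
Qed.

Lemma l1normD_le m n (M N : 'M[R]_(m, n)) a b :
  l1norm M <= a -> l1norm N <= b -> l1norm (M + N) <= a + b.
Proof. by move=> Ma Nb; apply: le_trans (ler_l1normD _ _) _; rewrite lerD. Qed.

Lemma l1normB_le m n (M N : 'M[R]_(m, n)) a b :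
  l1norm M <= a -> l1norm N <= b -> l1norm (M - N) <= a + b.
Proof. by move=> Ma Nb; apply: le_trans (ler_l1normB _ _) _; rewrite lerD. Qed.

End L1Norm.

Section OpNorm.
Context {R : realType}.

Lemma enorm_sqr n (v : 'cV[R]_n) : enorm v ^+ 2 = \sum_(i < n) v i 0 ^+ 2.
Proof. by rewrite sqr_sqrtr// sumr_ge0// => i _; rewrite sqr_ge0. Qed.

Lemma entry_le_enorm n (v : 'cV[R]_n) i : `|v i 0| <= enorm v.
Proof.
rewrite -(@ler_pXn2r _ 2) ?nnegrE// ?sqrtr_ge0// enorm_sqr real_normK ?num_real//.
by rewrite (bigD1 i)//= lerDl sumr_ge0// => k _; rewrite sqr_ge0.
Qed.

Lemma enorm_le_l1norm n (v : 'cV[R]_n) : enorm v <= l1norm v.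
Proof.
rewrite -(@ler_pXn2r _ 2) ?nnegrE ?l1norm_ge0 ?sqrtr_ge0// enorm_sqr.
rewrite expr2 {1}/l1norm mulr_suml; apply: ler_sum => i _.
rewrite big_ord1 -[v i 0 ^+ 2]real_normK ?num_real// expr2.
by rewrite ler_wpM2l// entry_le_l1norm.
Qed.

Lemma opnorm_set_ub m n (M : 'M[R]_(m, n)) :
  ubound [set enorm (M *m v) | v in [set v : 'cV[R]_n | enorm v <= 1]]
    (l1norm M * n%:R).
Proof.
move=> _ [v /= v1 <-]; apply: le_trans (enorm_le_l1norm _) _.
apply: l1normM_le => //; rewrite -[n%:R]mulr1 -{2}[n]muln1.
apply: l1norm_le_entries => i j; rewrite ord1.
exact: le_trans (entry_le_enorm _ _) v1.
Qed.

Lemma enorm_mulmx_le_opnorm m n (M : 'M[R]_(m, n)) (v : 'cV[R]_n) :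
  enorm v <= 1 -> enorm (M *m v) <= opnorm M.
Proof.
move=> v1; apply: ub_le_sup.
  by exists (l1norm M * n%:R); exact: opnorm_set_ub.
by exists v.
Qed.

Lemma opnorm_ge0 m n (M : 'M[R]_(m, n)) : 0 <= opnorm M.
Proof.
apply: le_trans (@enorm_mulmx_le_opnorm _ _ M 0 _); first exact: sqrtr_ge0.
by rewrite (le_trans (enorm_le_l1norm _))// l1norm0.
Qed.

(** An entry of [M] is an entry of the image of a basis vector. *)
Lemma entry_le_opnorm m n (M : 'M[R]_(m, n)) i j : `|M i j| <= opnorm M.
Proof.
have -> : M i j = (M *m (delta_mx j 0 : 'cV[R]_n)) i 0.
  by rewrite -colE mxE.
apply: le_trans (entry_le_enorm _ _) (enorm_mulmx_le_opnorm _ _).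
rewrite /enorm (bigD1 j)//= big1 ?mxE ?eqxx/= ?expr1n ?addr0 ?sqrtr1//.
by move=> k kj; rewrite mxE (negbTE kj) expr0n.
Qed.

Lemma l1norm_le_opnorm m n (M : 'M[R]_(m, n)) c :
  opnorm M <= c -> l1norm M <= (m * n)%:R * c.
Proof.
move=> Mc; apply: l1norm_le_entries => i j.
exact: le_trans (entry_le_opnorm _ _ _) Mc.
Qed.

End OpNorm.

Section Expect.
Context {R : realType} {I : finType}.
Hypothesis I0 : (0 < #|I|)%N.

Lemma expect_cst (V : lmodType R) (v : V) : expect (fun _ : I => v) = v.
Proof.
rewrite /expect sumr_const -(scaler_nat #|I| v) scalerA mulVf ?scale1r//.
by rewrite pnatr_eq0 -lt0n.
Qed.

Lemma expectB (V : lmodType R) (f : I -> V) (v : V) :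
  expect f - v = expect (fun s => f s - v).
Proof. by rewrite -{1}(expect_cst v) /expect sumrB scalerBr. Qed.

Lemma expectZ a (f : I -> R^o) :
  a * (expect f : R) = expect (fun s => a * f s : R^o).
Proof. by rewrite /expect /GRing.scale/= mulrCA mulr_sumr. Qed.

Lemma le_expect (f g : I -> R^o) :
  (forall s, f s <= g s) -> (expect f : R) <= expect g.
Proof.
by move=> fg; rewrite /expect ler_wpM2l// ?invr_ge0// ler_sum.
Qed.

Lemma expect_entry m n (f : I -> 'M[R]_(m, n)) i j :
  expect f i j = expect (fun s => f s i j : R^o).
Proof. by rewrite /expect mxE summxE. Qed.

Lemma norm_expect_le (f : I -> R^o) :
  `|expect f : R| <= expect (fun s => `|f s| : R^o).
Proof.
rewrite /expect normrM ger0_norm ?invr_ge0// ler_wpM2l// ?invr_ge0//.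
exact: ler_norm_sum.
Qed.

(** Jensen's inequality for the norm. *)
Lemma l1norm_expect_sub m n (f : I -> 'M[R]_(m, n)) M0 (q : I -> R^o) :
  (forall s, opnorm (f s - M0) <= q s) ->
  l1norm (expect f - M0) <= (m * n)%:R * expect q.
Proof.
move=> fq; apply: l1norm_le_entries => i j.
rewrite expectB expect_entry; apply: le_trans (norm_expect_le _) _.
by apply: le_expect => s; exact: le_trans (entry_le_opnorm _ _ _) (fq s).
Qed.

Lemma l1norm_expect_le m n (f : I -> 'M[R]_(m, n)) c :
  (forall s, opnorm (f s) <= c) -> l1norm (expect f) <= (m * n)%:R * c.
Proof.
move=> fc; rewrite -[expect f]subr0 -[X in _ * X](@expect_cst R^o c).
by apply: l1norm_expect_sub => s; rewrite subr0.
Qed.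

End Expect.

(** * Quadratic forms *)

Definition bform (R : realType) (n : nat) (M : 'M[R]_n) (u v : 'cV[R]_n) : R :=
  (u^T *m M *m v) 0 0.

Definition sqnorm (R : realType) (n : nat) (v : 'cV[R]_n) : R :=
  \sum_(i < n) v i 0 ^+ 2.

Definition psd (R : realType) (n : nat) (M : 'M[R]_n) : Prop :=
  forall v, 0 <= bform M v v.

Section QuadraticForms.
Context {R : realType} {n : nat}.
Implicit Types (M N : 'M[R]_n) (u v w : 'cV[R]_n).

Lemma bformDl M u v w : bform M (u + v) w = bform M u w + bform M v w.
Proof. by rewrite /bform linearD/= !mulmxDl mxE. Qed.

Lemma bformDr M u v w : bform M u (v + w) = bform M u v + bform M u w.
Proof. by rewrite /bform mulmxDr mxE. Qed.

Lemma bformZl M a u v : bform M (a *: u) v = a * bform M u v.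
Proof. by rewrite /bform linearZ/= -!scalemxAl mxE. Qed.

Lemma bformZr M a u v : bform M u (a *: v) = a * bform M u v.
Proof. by rewrite /bform -scalemxAr mxE. Qed.

Lemma bformD M N u v : bform (M + N) u v = bform M u v + bform N u v.
Proof. by rewrite /bform mulmxDr mulmxDl mxE. Qed.

Lemma bformB M N u v : bform (M - N) u v = bform M u v - bform N u v.
Proof. by rewrite /bform mulmxBr mulmxBl !mxE. Qed.

Lemma bformZ a M u v : bform (a *: M) u v = a * bform M u v.
Proof. by rewrite /bform -scalemxAr -scalemxAl mxE. Qed.

Lemma bformC M u v : M^T = M -> bform M u v = bform M v u.
Proof.
move=> Ms; rewrite /bform -[u^T *m M *m v]trmxK [LHS]mxE.
by rewrite !trmx_mul trmxK Ms mulmxA.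
Qed.

Lemma bformE M u v : bform M u v = \sum_i \sum_j u i 0 * M i j * v j 0.
Proof.
rewrite /bform mxE exchange_big; apply: eq_bigr => j _.
by rewrite mxE mulr_suml; apply: eq_bigr => i _; rewrite mxE.
Qed.

Lemma sqnorm_ge0 v : 0 <= sqnorm v.
Proof. by apply: sumr_ge0 => i _; rewrite sqr_ge0. Qed.

Lemma sqr_entry_le_sqnorm v i : v i 0 ^+ 2 <= sqnorm v.
Proof.
by rewrite /sqnorm (bigD1 i)//= lerDl sumr_ge0// => k _; rewrite sqr_ge0.
Qed.

Lemma sqnorm_eq0 v : sqnorm v = 0 -> v = 0.
Proof.
move=> v0; apply/colP => i; rewrite mxE; apply/eqP; rewrite -sqrf_eq0 eq_le.
by rewrite sqr_ge0 -v0 sqr_entry_le_sqnorm.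
Qed.

Lemma sqnormZ a v : sqnorm (a *: v) = a ^+ 2 * sqnorm v.
Proof.
by rewrite /sqnorm mulr_sumr; apply: eq_bigr => i _; rewrite mxE exprMn.
Qed.

Lemma bform1 v : bform 1%:M v v = sqnorm v.
Proof.
by rewrite /bform mulmx1 mxE; apply: eq_bigr => i _; rewrite mxE expr2.
Qed.

Lemma norm_bform_sqnorm_le M v : `|bform M v v| <= l1norm M * sqnorm v.
Proof.
rewrite bformE; apply: le_trans (ler_norm_sum _ _ _) _.
rewrite mulr_suml; apply: ler_sum => i _.
apply: le_trans (ler_norm_sum _ _ _) _.
rewrite mulr_suml; apply: ler_sum => j _.
rewrite !normrM mulrAC mulrC ler_wpM2l//.
have hi := sqr_entry_le_sqnorm v i; have hj := sqr_entry_le_sqnorm v j.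
rewrite -[v i 0 ^+ 2]real_normK ?num_real// in hi.
rewrite -[v j 0 ^+ 2]real_normK ?num_real// in hj.
have := sqr_ge0 (`|v i 0| - `|v j 0|); nra.
Qed.

Lemma norm_bform_l1norm_le M v : `|bform M v v| <= l1norm M * l1norm v ^+ 2.
Proof.
apply: le_trans (entry_le_l1norm _ 0 0) _.
have -> : l1norm M * l1norm v ^+ 2 = l1norm v * l1norm M * l1norm v by ring.
by apply: l1normM_le => //; apply: l1normM_le => //; rewrite l1norm_tr.
Qed.

(** [bform M (u + s v) (u + s v)] is a nonnegative polynomial of degree at most
    two in [s], so its discriminant is nonpositive. *)
Lemma psd_cauchy_schwarz M u v : M^T = M -> psd M ->
  bform M u v ^+ 2 <= bform M u u * bform M v v.
Proof.
move=> Ms Mp; set a := bform M u u; set b := bform M u v; set c := bform M v v.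
have q s : 0 <= a + 2 * s * b + s ^+ 2 * c.
  have := Mp (u + s *: v); rewrite !bformDl !bformDr !bformZl !bformZr.
  by rewrite (bformC v u Ms) -/a -/b -/c; nra.
have c0 : 0 <= c by exact: Mp.
have [c_gt0|c_le0] := ltP 0 c.
  have := q (- b / c).
  have -> : a + 2 * (- b / c) * b + (- b / c) ^+ 2 * c = (a * c - b ^+ 2) / c.
    by field; rewrite gt_eqF.
  by rewrite pmulr_lge0 ?invr_gt0// subr_ge0.
have cE : c = 0 by apply/eqP; rewrite eq_le c_le0 c0.
have [->|b0] := eqVneq b 0; first by rewrite expr0n mulr_ge0//; exact: Mp.
(* The polynomial is affine and takes the value [-1] here. *)
have := q (- (a + 1) / (2 * b)); rewrite cE mulr0 addr0.
have -> : 2 * (- (a + 1) / (2 * b)) * b = - (a + 1) by field.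
by rewrite opprD addNKr lerNr oppr0 ler10.
Qed.

Lemma psd_kernel M v : M^T = M -> psd M -> bform M v v = 0 -> M *m v = 0.
Proof.
move=> Ms Mp v0; apply/colP => i; rewrite [RHS]mxE.
have -> : (M *m v) i 0 = bform M (delta_mx i 0) v.
  by rewrite /bform -mulmxA trmx_delta -rowE [RHS]mxE.
apply/eqP; rewrite -sqrf_eq0 eq_le sqr_ge0 andbT.
by rewrite (le_trans (psd_cauchy_schwarz _ _ Ms Mp))// v0 mulr0.
Qed.

Lemma posdef_psd M : posdef M -> psd M.
Proof.
move=> [_ Mp] v; have [->|v0] := eqVneq v 0; last exact/ltW/Mp.
by rewrite /bform mulmx0 mxE.
Qed.

Lemma definite_unitmx M : (forall v, v != 0 -> bform M v v != 0) -> M \in unitmx.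
Proof.
move=> Md; rewrite -row_free_unit -kermx_eq0; apply/rowV0P => v /sub_kermxP vM.
apply/eqP; apply: contraT => v0.
have /Md : v^T != 0 by rewrite -trmx0 (inj_eq trmx_inj).
by rewrite /bform trmxK vM mul0mx mxE eqxx.
Qed.

Lemma posdef_unitmx M : posdef M -> M \in unitmx.
Proof. by move=> [_ Mp]; apply: definite_unitmx => v /Mp v0; rewrite gt_eqF. Qed.

(** Cauchy-Schwarz for the form [M], applied to [v] and [M^-1 v]. *)
Lemma posdef_coercive M v : posdef M ->
  sqnorm v <= l1norm (invmx M) * bform M v v.
Proof.
move=> Mp; have Mu := posdef_unitmx Mp.
have := psd_cauchy_schwarz v (invmx M *m v) (proj1 Mp) (posdef_psd Mp).
have -> : bform M v (invmx M *m v) = sqnorm v.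
  by rewrite -bform1 /bform -mulmxA mulKVmx// mulmx1.
have -> : bform M (invmx M *m v) (invmx M *m v) = bform (invmx M) v v.
  by rewrite /bform trmx_mul trmx_inv (proj1 Mp) -!mulmxA mulKVmx.
move=> vv; have [v0|v0] := eqVneq (sqnorm v) 0.
  by rewrite v0 mulr_ge0 ?l1norm_ge0//; exact: posdef_psd.
have v_gt0 : 0 < sqnorm v by rewrite lt_neqAle eq_sym v0 sqnorm_ge0.
rewrite -(ler_pM2r v_gt0) -expr2 mulrAC [X in _ <= X]mulrC.
apply: le_trans vv _; rewrite ler_wpM2l//; first exact: posdef_psd.
exact: le_trans (ler_norm _) (norm_bform_sqnorm_le _ _).
Qed.

(** For [v = M^-1 e_j], coercivity reads [|v|^2 <= c v_j], hence [|v| <= c]. *)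
Lemma coercive_invmx M c : 0 <= c ->
  (forall v, sqnorm v <= c * bform M v v) ->
  l1norm (invmx M) <= (n * n)%:R * c.
Proof.
move=> c0 Mc.
have Mu : M \in unitmx.
  apply: definite_unitmx => v; apply: contra_neq => v0; apply: sqnorm_eq0.
  by apply/eqP; rewrite eq_le sqnorm_ge0 andbT -[leRHS](mulr0 c) -v0 Mc.
apply: l1norm_le_entries => i j.
set v := invmx M *m (delta_mx j 0 : 'cV[R]_n).
have -> : invmx M i j = v i 0 by rewrite /v -colE mxE.
have := Mc v.
have -> : bform M v v = v j 0.
  rewrite /bform -mulmxA {2}/v mulKVmx//.
  by rewrite -[v^T *m _]trmxK trmx_mul trmxK trmx_delta -rowE !mxE.
move=> vj; have v2 : sqnorm v <= c ^+ 2.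
  have hj := sqr_entry_le_sqnorm v j.
  have := sqr_ge0 (v j 0 - c); nra.
rewrite -(@ler_pXn2r _ 2) ?nnegrE// real_normK ?num_real//.
exact: le_trans (sqr_entry_le_sqnorm _ _) v2.
Qed.

Lemma psd_diag_ge0 M i : psd M -> 0 <= M i i.
Proof.
move=> /(_ (delta_mx i 0)); rewrite /bform -mulmxA trmx_delta -rowE mxE.
by rewrite -colE mxE.
Qed.

(** The form at [e_i + e_j] and [e_i - e_j] gives
    [|M i j| <= (M i i + M j j) / 2]. *)
Lemma psd_l1norm_trace M : M^T = M -> psd M ->
  l1norm M <= (n * n)%:R * \tr M.
Proof.
move=> Ms Mp; apply: l1norm_le_entries => i j.
have diag k : M k k <= \tr M.
  by rewrite /mxtrace (bigD1 k)//= lerDl sumr_ge0// => l _; exact: psd_diag_ge0.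
have e k l : bform M (delta_mx k 0) (delta_mx l 0) = M k l.
  by rewrite /bform -mulmxA trmx_delta -rowE mxE -colE mxE.
have Mij : M j i = M i j by rewrite -[in LHS]Ms mxE.
have := Mp (delta_mx i 0 + delta_mx j 0).
have := Mp (delta_mx i 0 + (-1) *: delta_mx j 0).
rewrite !bformDl !bformDr !bformZl !bformZr !e Mij.
have := diag i; have := diag j; have := psd_diag_ge0 i Mp.
have := psd_diag_ge0 j Mp.
by move=> *; rewrite ler_norml; apply/andP; split; lra.
Qed.

End QuadraticForms.

Section ExpectForms.
Context {R : realType} {I : finType}.
Hypothesis I0 : (0 < #|I|)%N.

Lemma expect_sym n (f : I -> 'M[R]_n) :
  (forall s, (f s)^T = f s) -> (expect f)^T = expect f.
Proof.
move=> fs; rewrite /expect linearZ/= linear_sum/=; congr (_ *: _).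
by apply: eq_bigr => s _; exact: fs.
Qed.

Lemma bform_expect n (f : I -> 'M[R]_n) u v :
  bform (expect f) u v = expect (fun s => bform (f s) u v : R^o).
Proof.
by rewrite /expect bformZ /bform mulmx_sumr mulmx_suml summxE.
Qed.

Lemma expect_posdef n (f : I -> 'M[R]_n) :
  (forall s, posdef (f s)) -> posdef (expect f).
Proof.
move=> fp; split; first by apply: expect_sym => s; case: (fp s).
move=> v v0; rewrite -/(bform _ _ _) bform_expect /expect.
rewrite /GRing.scale/= mulr_gt0 ?invr_gt0 ?ltr0n//.
have /card_gt0P [s0 _] := I0; rewrite (bigD1 s0)//= ltr_pwDl//.
  by case: (fp s0) => _; apply.
by apply: sumr_ge0 => s _; exact: posdef_psd.
Qed.

(** Bounds on inverses do not pass to a mean directly; coercivity does. *)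
Lemma l1norm_invmx_expect n (f : I -> 'M[R]_n) c : 0 <= c ->
  (forall s, posdef (f s)) -> (forall s, opnorm (invmx (f s)) <= c) ->
  l1norm (invmx (expect f)) <= (n * n)%:R * ((n * n)%:R * c).
Proof.
move=> c0 fp fc; apply: coercive_invmx; first by rewrite mulr_ge0.
move=> v; rewrite bform_expect expectZ -[leLHS](@expect_cst _ _ I0 R^o).
apply: le_expect => s.
apply: le_trans (posdef_coercive _ (fp s)) _; rewrite ler_wpM2r//.
  exact: posdef_psd.
exact: l1norm_le_opnorm.
Qed.

End ExpectForms.

(** * Matrix-valued functions of a real variable *)

(** Continuity and derivatives are taken entrywise, so that the rules for real
    functions carry over to products of matrices of all formats. *)
Definition mx_cont (R : realType) (m n : nat) (A : set R)
    (P : R -> 'M[R]_(m, n)) : Prop :=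
  forall i j, {within A, continuous (fun t => P t i j)}.

Definition mx_deriv (R : realType) (m n : nat) (t : R) (P : R -> 'M[R]_(m, n))
    (D : 'M[R]_(m, n)) : Prop :=
  forall i j, is_derive t 1 (fun s => P s i j) (D i j).

Section WithinContinuity.
Context {R : realType} {X : topologicalType}.
Implicit Types (A : set X).

Lemma within_cst A (c : R) : {within A, continuous (fun _ : X => c)}.
Proof. by move=> x; apply: cvg_cst. Qed.

Lemma withinD A (f g : X -> R) : {within A, continuous f} ->
  {within A, continuous g} -> {within A, continuous (fun t => f t + g t)}.
Proof.
move=> cf cg x; apply: (@continuousD _ _ _ (f : subspace A -> R) g).
  exact: cf.
exact: cg.
Qed.

Lemma withinM A (f g : X -> R) : {within A, continuous f} ->
  {within A, continuous g} -> {within A, continuous (fun t => f t * g t)}.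
Proof.
move=> cf cg x; apply: (@continuousM _ _ (f : subspace A -> R) g).
  exact: cf.
exact: cg.
Qed.

Lemma withinN A (f : X -> R) : {within A, continuous f} ->
  {within A, continuous (fun t => - f t)}.
Proof.
by move=> cf x; apply: (@continuousN _ _ _ (f : subspace A -> R)); exact: cf.
Qed.

Lemma within_norm A (f : X -> R) : {within A, continuous f} ->
  {within A, continuous (fun t => `|f t|)}.
Proof. by move=> cf x; apply: cvg_norm; exact: cf. Qed.

Lemma within_sum A n (f : 'I_n -> X -> R) :
  (forall i, {within A, continuous (f i)}) ->
  {within A, continuous (fun t => \sum_i f i t)}.
Proof.
move=> cf; elim: n f cf => [|n IH] f cf.
  rewrite (_ : (fun _ => _) = fun=> 0); first exact: within_cst.
  by apply/funext => t; rewrite big_ord0.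
rewrite (_ : (fun _ => _) = fun t => f ord0 t + \sum_(i < n) f (lift ord0 i) t).
  by apply: withinD => //; exact: IH.
by apply/funext => t; rewrite big_ord_recl.
Qed.

End WithinContinuity.

Section MatrixFunctions.
Context {R : realType}.
Implicit Types (A : set R) (t : R).

Lemma mx_cont_within m n A (P : R -> 'M[R]_(m, n)) :
  {within A, continuous P} -> mx_cont A P.
Proof.
move=> cP i j x.
apply: (@continuous_comp (subspace A) _ _ P (fun M : 'M[R]_(m, n) => M i j) x).
  exact: cP.
exact: coord_continuous.
Qed.

Lemma mx_cont_cst m n A (M : 'M[R]_(m, n)) : mx_cont A (fun=> M).
Proof. by move=> i j; exact: within_cst. Qed.

Lemma mx_contD m n A (P Q : R -> 'M[R]_(m, n)) :
  mx_cont A P -> mx_cont A Q -> mx_cont A (fun t => P t + Q t).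
Proof.
move=> cP cQ i j; rewrite (_ : (fun _ => _) = fun t => P t i j + Q t i j).
  exact: withinD.
by apply/funext => t; rewrite mxE.
Qed.

Lemma mx_contN m n A (P : R -> 'M[R]_(m, n)) :
  mx_cont A P -> mx_cont A (fun t => - P t).
Proof.
move=> cP i j; rewrite (_ : (fun _ => _) = fun t => - P t i j).
  exact: withinN.
by apply/funext => t; rewrite mxE.
Qed.

Lemma mx_contB m n A (P Q : R -> 'M[R]_(m, n)) :
  mx_cont A P -> mx_cont A Q -> mx_cont A (fun t => P t - Q t).
Proof. by move=> cP cQ; apply: mx_contD => //; exact: mx_contN. Qed.

Lemma mx_contM m n p A (P : R -> 'M[R]_(m, n)) (Q : R -> 'M[R]_(n, p)) :
  mx_cont A P -> mx_cont A Q -> mx_cont A (fun t => P t *m Q t).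
Proof.
move=> cP cQ i j.
rewrite (_ : (fun _ => _) = fun t => \sum_k P t i k * Q t k j).
  by apply: within_sum => k; exact: withinM.
by apply/funext => t; rewrite mxE.
Qed.

Lemma mx_cont_tr m n A (P : R -> 'M[R]_(m, n)) :
  mx_cont A P -> mx_cont A (fun t => (P t)^T).
Proof.
move=> cP i j; rewrite (_ : (fun _ => _) = fun t => P t j i) //.
by apply/funext => t; rewrite mxE.
Qed.

Lemma mx_contZ m n A (f : R -> R) (P : R -> 'M[R]_(m, n)) :
  {within A, continuous f} -> mx_cont A P -> mx_cont A (fun t => f t *: P t).
Proof.
move=> cf cP i j; rewrite (_ : (fun _ => _) = fun t => f t * P t i j) //.
  exact: withinM.
by apply/funext => t; rewrite mxE.
Qed.

Lemma within_l1norm m n A (P : R -> 'M[R]_(m, n)) :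
  mx_cont A P -> {within A, continuous (fun t => l1norm (P t))}.
Proof.
move=> cP; rewrite /l1norm.
apply: (@within_sum _ _ _ _ (fun i t => \sum_j `|P t i j|)) => i.
by apply: (@within_sum _ _ _ _ (fun j t => `|P t i j|)) => j; exact: within_norm.
Qed.

Lemma mx_cont_bounded m n a b (P : R -> 'M[R]_(m, n)) : a <= b ->
  mx_cont `[a, b] P ->
  exists2 M, 0 <= M & forall t, a <= t <= b -> l1norm (P t) <= M.
Proof.
move=> ab /within_l1norm/(EVT_max ab)[c _ hc].
exists (l1norm (P c)); first exact: l1norm_ge0.
by move=> t tab; apply: hc; rewrite in_itv.
Qed.

Lemma is_derive_mx_deriv m n t (P : R -> 'M[R]_(m, n)) D :
  is_derive t 1 P D -> mx_deriv t P D.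
Proof.
move=> [dP PD] i j; split; first by have /derivable_mxP := dP; apply.
by rewrite -PD derive_mx// mxE.
Qed.

Lemma is_derive_eq_fun (f g : R -> R) t d : f = g ->
  is_derive t 1 f d -> is_derive t 1 g d.
Proof. by move=> ->. Qed.

Lemma is_derive_sum_fun n (f : 'I_n -> R -> R) (d : 'I_n -> R) t :
  (forall i, is_derive t 1 (f i) (d i)) ->
  is_derive t 1 (fun s => \sum_i f i s) (\sum_i d i).
Proof.
move=> fd; have := @is_derive_sum _ _ _ _ f t 1 d fd.
by apply: is_derive_eq_fun; apply/funext => s; rewrite fct_sumE.
Qed.

Lemma is_deriveM_fun (f g : R -> R) t df dg :
  is_derive t 1 f df -> is_derive t 1 g dg ->
  is_derive t 1 (fun s => f s * g s) (df * g t + f t * dg).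
Proof.
move=> fd gd; apply: is_derive_eq.
by rewrite /GRing.scale/= addrC [g t * _]mulrC.
Qed.

Lemma mx_derivB m n t (P Q : R -> 'M[R]_(m, n)) D E :
  mx_deriv t P D -> mx_deriv t Q E -> mx_deriv t (fun s => P s - Q s) (D - E).
Proof.
move=> dP dQ i j; have := is_deriveB (dP i j) (dQ i j); rewrite !mxE.
by apply: is_derive_eq_fun; apply/funext => s; rewrite !mxE.
Qed.

Lemma mx_deriv_tr m n t (P : R -> 'M[R]_(m, n)) D :
  mx_deriv t P D -> mx_deriv t (fun s => (P s)^T) D^T.
Proof.
move=> dP i j; rewrite mxE.
by apply: is_derive_eq_fun (dP j i); apply/funext => s; rewrite mxE.
Qed.

Lemma mx_deriv_bform n t (P : R -> 'M[R]_n) D u v :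
  mx_deriv t P D -> is_derive t 1 (fun s => bform (P s) u v) (bform D u v).
Proof.
move=> dP; rewrite bformE.
apply: (@is_derive_eq_fun (fun s => \sum_i \sum_j u i 0 * P s i j * v j 0)).
  by apply/funext => s; rewrite bformE.
apply: is_derive_sum_fun => i; apply: is_derive_sum_fun => j.
have dP' := dP i j.
apply: (@is_derive_eq_fun (fun s => (u i 0 * v j 0) * P s i j)).
  by apply/funext => s; rewrite mulrAC.
have := is_deriveZ (u i 0 * v j 0) (dP i j).
by rewrite /GRing.scale/= mulrAC.
Qed.

Lemma is_derive_expRM a t :
  is_derive t 1 (fun s => expR (a * s)) (a * expR (a * t)).
Proof.
have lin : is_derive t 1 (fun s => a * s) a.
  by have := is_deriveZ a (is_derive_id t 1); rewrite /GRing.scale/= mulr1.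
rewrite mulrC.
exact: (@is_derive1_comp _ expR (fun s => a * s) t _ _ (is_derive_expR _) lin).
Qed.

Lemma within_expRM A (a : R) : {within A, continuous (fun t => expR (a * t))}.
Proof.
apply: continuous_subspaceT => t; apply: differentiable_continuous.
by apply/derivable1_diffP; have [] := is_derive_expRM a t.
Qed.

End MatrixFunctions.

(** * Differential inequalities *)

Section Gronwall.
Context {R : realType}.
Implicit Types s t : R.

(** [expR (- a * t) * f t - b * t] is nonincreasing. *)
Lemma gronwall (T a b : R) (f df : R -> R) : 0 <= a -> 0 <= b ->
  {within `[0, T], continuous f} ->
  (forall t, 0 < t < T -> is_derive t 1 f (df t)) ->
  (forall t, 0 < t < T -> df t <= a * f t + b) ->
  forall t, 0 <= t <= T -> f t <= (f 0 + b * t) * expR (a * t).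
Proof.
move=> a0 b0 cf fd dfle t /andP[t0 tT].
pose g s := expR (- a * s) * f s + (- b) * s.
have gd s : 0 < s < T -> is_derive s 1 g
    (- a * expR (- a * s) * f s + expR (- a * s) * df s + (- b)).
  move=> sT; have h1 := is_deriveM_fun (is_derive_expRM (- a) s) (fd _ sT).
  have h2 : is_derive s 1 (fun s => - b * s) (- b).
    by have := is_deriveZ (- b) (is_derive_id s 1); rewrite /GRing.scale/= mulr1.
  exact: is_deriveD h1 h2.
have cg : {within `[0, T], continuous g}.
  apply: withinD; first by apply: withinM => //; exact: within_expRM.
  apply: continuous_subspaceT => s.
  by apply: cvgM; [exact: cvg_cst|exact: cvg_id].
have : g t <= g 0.
  apply: (@ler0_derive1_le_cc _ g 0 T) => //; last 2 first.
  - by rewrite in_itv/= t0.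
  - by rewrite in_itv/= lexx (le_trans t0 tT).
  - by move=> s; rewrite in_itv/= => /gd[].
  move=> s; rewrite in_itv/= => sT; rewrite derive1E.
  have [_ ->] := gd s sT.
  have e0 := expR_ge0 (- a * s).
  have e1 : expR (- a * s) <= 1.
    rewrite expR_le1 mulNr oppr_le0 mulr_ge0//.
    by case/andP: sT => /ltW.
  have := dfle s sT; nra.
rewrite /g !mulr0 expR0 mul1r addr0 [- b * t]mulNr lerBlDr => h.
rewrite -(@ler_pM2l _ (expR (- a * t))) ?expR_gt0// [X in _ <= X]mulrCA -expRD.
by rewrite mulNr addNr expR0 mulr1 -mulNr.
Qed.

(** The factor by which a norm satisfying [u' <= a u + b] can grow up to time
    [T], with the loss incurred by passing to the sum of squares. *)
Definition growth (a T : R) (m n : nat) : R :=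
  (m * n)%:R * Num.sqrt ((1 + T) * expR ((2 * a + 1) * (m * n)%:R ^+ 2 * T)).

(** The sum [e] of the squares of the entries is differentiable, unlike the
    norm, and satisfies [e' <= (2 a + 1) (m n)^2 e + b^2]. *)
Lemma mx_gronwall (T a b d : R) m n (P D : R -> 'M[R]_(m, n)) :
  0 <= T -> 0 <= a -> 0 <= b -> 0 <= d ->
  mx_cont `[0, T] P ->
  (forall t, 0 < t < T -> mx_deriv t P (D t)) ->
  (forall t, 0 < t < T -> l1norm (D t) <= a * l1norm (P t) + b) ->
  l1norm (P 0) <= d ->
  forall t, 0 <= t <= T -> l1norm (P t) <= growth a T m n * (d + b).
Proof.
move=> T0 a0 b0 d0 cP dP Dle P0 t tT.
pose e s := \sum_i \sum_j P s i j * P s i j.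
pose de s := \sum_i \sum_j (D s i j * P s i j + P s i j * D s i j).
set N : R := (m * n)%:R.
have e_l1 s : e s <= l1norm (P s) ^+ 2.
  rewrite expr2 {1}/l1norm mulr_suml; apply: ler_sum => i _.
  rewrite mulr_suml; apply: ler_sum => j _.
  apply: le_trans (ler_norm _) _; rewrite normrM ler_wpM2l//.
  exact: entry_le_l1norm.
have e0 s : 0 <= e s.
  by apply: sumr_ge0 => i _; apply: sumr_ge0 => j _; rewrite -expr2 sqr_ge0.
have l1_sqrt s : l1norm (P s) <= N * Num.sqrt (e s).
  apply: l1norm_le_entries => i j.
  rewrite -sqrtr_sqr ler_wsqrtr// /e (bigD1 i)//= (bigD1 j)//= -addrA -expr2.
  rewrite lerDl.
  apply: addr_ge0; first by apply: sumr_ge0 => k _; rewrite -expr2 sqr_ge0.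
  by apply: sumr_ge0 => k _; apply: sumr_ge0 => l _; rewrite -expr2 sqr_ge0.
have l1_e s : l1norm (P s) ^+ 2 <= N ^+ 2 * e s.
  rewrite -[in leRHS](sqr_sqrtr (e0 s)) -exprMn ler_pXn2r ?nnegrE ?l1norm_ge0//.
  by rewrite mulr_ge0// sqrtr_ge0.
have ce : {within `[0, T], continuous e}.
  apply: (@within_sum _ _ _ _ (fun i s => \sum_j P s i j * P s i j)) => i.
  apply: (@within_sum _ _ _ _ (fun j s => P s i j * P s i j)) => j.
  exact: withinM.
have ed s : 0 < s < T -> is_derive s 1 e (de s).
  move=> sT.
  apply: (@is_derive_sum_fun _ _ (fun i s => \sum_j P s i j * P s i j)) => i.
  apply: (@is_derive_sum_fun _ _ (fun j s => P s i j * P s i j)) => j.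
  exact: is_deriveM_fun (dP s sT i j) (dP s sT i j).
have N0 : 0 <= N by [].
have dele s : 0 < s < T -> de s <= (2 * a + 1) * N ^+ 2 * e s + b ^+ 2.
  move=> sT.
  have : de s <= 2 * (l1norm (P s) * l1norm (D s)).
    rewrite mulrCA {1}/l1norm mulr_suml; apply: ler_sum => i _.
    rewrite mulr_suml; apply: ler_sum => j _.
    have h := entry_le_l1norm (D s) i j.
    have -> : D s i j * P s i j + P s i j * D s i j =
      P s i j * (2 * D s i j) by ring.
    apply: le_trans (ler_norm _) _; rewrite !normrM normr_nat// ler_wpM2l//.
    by rewrite ler_wpM2l.
  have := Dle s sT; have := l1norm_ge0 (P s); have := l1_e s.
  have := sqr_ge0 (l1norm (P s) - b).
  set l := l1norm (P s); set ld := l1norm (D s); move=> h1 h2 h3 h4 h5.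
  have h6 : l * ld <= l * (a * l + b) by rewrite ler_wpM2l.
  have h7 : (2 * a + 1) * l ^+ 2 <= (2 * a + 1) * (N ^+ 2 * e s).
    by rewrite ler_wpM2l// addr_ge0// mulr_ge0.
  rewrite -mulrA; nra.
have a'0 : 0 <= (2 * a + 1) * N ^+ 2.
  by rewrite mulr_ge0 ?sqr_ge0// addr_ge0// mulr_ge0.
have := gronwall a'0 (sqr_ge0 b) ce ed dele tT.
have /andP[t0 tT'] := tT.
set E := expR _ => het.
have E0 : 0 <= E by exact: expR_ge0.
have EE : E <= expR ((2 * a + 1) * N ^+ 2 * T) by rewrite ler_expR ler_wpM2l.
set E' := expR _ in EE.
have eP : e t <= (1 + T) * E' * (d + b) ^+ 2.
  apply: le_trans het _.
  have e00 : e 0 <= d ^+ 2.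
    by apply: le_trans (e_l1 0) _; rewrite ler_pXn2r ?nnegrE ?l1norm_ge0.
  have : e 0 + b ^+ 2 * t <= (1 + T) * (d + b) ^+ 2.
    have : b ^+ 2 * t <= b ^+ 2 * T by rewrite ler_wpM2l// sqr_ge0.
    have : 0 <= T * (d * (d + 2 * b)) by rewrite !mulr_ge0// addr_ge0// mulr_ge0.
    have : 0 <= d * b by exact: mulr_ge0.
    have := sqr_ge0 b; lra.
  move=> h; rewrite [leRHS]mulrAC ler_pM//.
  by rewrite addr_ge0 ?mulr_ge0 ?sqr_ge0 ?e0.
apply: le_trans (l1_sqrt t) _; rewrite /growth -[leRHS]mulrA ler_wpM2l ?ler0n//.
have -> : d + b = Num.sqrt ((d + b) ^+ 2).
  by rewrite sqrtr_sqr ger0_norm// addr_ge0.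
rewrite -sqrtrM ?ler_wsqrtr//.
by rewrite mulr_ge0 ?expR_ge0// addr_ge0.
Qed.

End Gronwall.

(** * Invariance of the positive semidefinite cone *)

Section PsdCone.
Context {R : realType}.
Implicit Types s t : R.

Lemma within_fst (X Y : topologicalType) (A : set X) (B : set Y) (h : X -> R) :
  {within A, continuous h} -> {within A `*` B, continuous (fun p => h p.1)}.
Proof.
move=> /subspace_continuousP ch; apply/subspace_continuousP => -[x y] [/= Ax By].
move=> U /(ch x Ax) hU.
have fstc : (fun p : X * Y => p.1) @ nbhs (x, y) --> x by exact: cvg_fst.
have hn : nbhs (x, y) (fun p : X * Y => A p.1 -> U (h p.1)) := fstc _ hU.
change (nbhs (x, y) (fun p : X * Y => (A `*` B) p -> U (h p.1))).
by apply: filterS hn => -[x' y'] /= h' [Ax' _]; exact: h'.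
Qed.

Lemma continuous_sqnorm n : continuous (fun v : 'rV[R]_n => sqnorm v^T).
Proof.
move=> v.
have : {within [set: 'rV[R]_n], continuous (fun v : 'rV[R]_n => sqnorm v^T)}.
  rewrite (_ : (fun _ => _) = fun v : 'rV[R]_n => \sum_i v 0 i * v 0 i).
    apply: within_sum => i.
    by apply: withinM; apply: continuous_subspaceT => w; exact: coord_continuous.
  by apply/funext => u; apply: eq_bigr => i _; rewrite mxE expr2.
by move=> /(continuous_subspace_setT (fun v : 'rV[R]_n => sqnorm v^T)).2; apply.
Qed.

Lemma compact_sphere n : compact [set v : 'rV[R]_n | sqnorm v^T = 1].
Proof.
apply: (@subclosed_compact _ _
  [set v : 'rV[R]_n | forall i, `[-1, 1]%classic (v ord0 i)]).
- apply: (@preimage_closed _ _ (fun v : 'rV[R]_n => sqnorm v^T) [set 1]).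
    by move=> v _; exact: continuous_sqnorm.
  exact: closed_eq.
- apply: (@rV_compact R n (fun=> `[-1, 1]%classic)) => _.
  exact: segment_compact.
move=> v /= v1 i; rewrite in_itv/= -ler_norml.
rewrite -(@ler_pXn2r _ 2) ?nnegrE// real_normK ?num_real// expr1n -v1.
by have := sqr_entry_le_sqnorm v^T i; rewrite mxE.
Qed.

Lemma within_bform_prod n (A : set R) (B : set 'rV[R]_n) (Y : R -> 'M[R]_n) :
  mx_cont A Y ->
  {within A `*` B, continuous (fun p => bform (Y p.1) p.2^T p.2^T)}.
Proof.
move=> cY; rewrite (_ : (fun _ => _) =
    fun p : R * 'rV[R]_n => \sum_i \sum_j p.2 0 i * Y p.1 i j * p.2 0 j); last first.
  apply/funext => p; rewrite bformE; apply: eq_bigr => i _.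
  by apply: eq_bigr => j _; rewrite !mxE.
have csnd i : {within A `*` B, continuous (fun p : R * 'rV[R]_n => p.2 0 i)}.
  apply: continuous_subspaceT => p.
  apply: (@continuous_comp _ _ _ snd (fun v : 'rV[R]_n => v 0 i)).
    exact: cvg_snd.
  exact: coord_continuous.
apply: within_sum => i; apply: within_sum => j.
apply: withinM => //; apply: withinM => //.
exact: (@within_fst _ _ _ _ (fun t => Y t i j)).
Qed.

(** The difference quotients from the left are nonpositive. *)
Lemma left_min_deriv_le0 (g : R -> R) t d : 0 < t ->
  is_derive t 1 g d -> (forall s, 0 <= s <= t -> g t <= g s) -> d <= 0.
Proof.
move=> t0 [dg gd] gmin; rewrite leNgt; apply/negP => d0.
have h : h^-1 *: (g (h *: 1 + t) - g t) @[h --> 0^'] --> d.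
  by rewrite -gd; exact: dg.
have : nbhs (0 : R) (fun k : R => k != 0 -> 0 < k^-1 *: (g (k *: 1 + t) - g t)).
  exact: (cvgr_gt d h 0 d0).
move=> /nbhs_ballP [e /= e0 he].
pose k := Num.min (e / 2) t.
have k0 : 0 < k by rewrite lt_min t0 divr_gt0.
have ke : k < e by rewrite gt_min ltr_pdivrMr// ltr_pMr// ltr1n.
have kt : k <= t by rewrite ge_min lexx orbT.
have := he (- k); rewrite /ball/= sub0r opprK gtr0_norm// oppr_eq0 gt_eqF//.
move=> /(_ ke isT); rewrite /GRing.scale/= mulr1 invrN mulNr oppr_gt0.
rewrite pmulr_rlt0 ?invr_gt0// subr_lt0 ltNge gmin//.
by rewrite addrC subr_ge0 kt lerBlDr lerDl ltW.
Qed.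

(** [M - lam 1] is positive semidefinite and its form vanishes at [v]. *)
Lemma bform_min_eigen n (M : 'M[R]_n) lam (v : 'cV[R]_n) : M^T = M ->
  sqnorm v = 1 -> bform M v v = lam ->
  (forall u, sqnorm u = 1 -> lam <= bform M u u) -> M *m v = lam *: v.
Proof.
move=> Ms v1 vlam umin.
have : (M - lam *: 1%:M) *m v = 0.
  apply: psd_kernel.
  - by rewrite linearB linearZ/= trmx1 Ms.
  - move=> u; rewrite bformB bformZ bform1.
    have [->|u0] := eqVneq u 0.
      rewrite /bform mulmx0 mxE /sqnorm big1 ?mulr0 ?subrr// => i _.
      by rewrite mxE expr0n.
    have u_gt0 : 0 < sqnorm u.
      rewrite lt_neqAle sqnorm_ge0 andbT eq_sym.
      by apply: contra_neq u0; exact: sqnorm_eq0.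
    set c := Num.sqrt (sqnorm u).
    have c0 : 0 < c by rewrite sqrtr_gt0.
    have c2 : c ^+ 2 = sqnorm u by rewrite sqr_sqrtr// ltW.
    have := umin (c^-1 *: u); rewrite sqnormZ -c2 -exprMn mulVf ?gt_eqF// expr1n.
    move=> /(_ erefl); rewrite bformZl bformZr mulrA -expr2 exprVn.
    by rewrite ler_pdivlMl ?exprn_gt0// mulrC subr_ge0.
  - by rewrite bformB bformZ bform1 v1 mulr1 vlam subrr.
by rewrite mulmxBl -scalemxAl mul1mx => /subr0_eq.
Qed.

(** At a negative minimum of [exp(- L t) v^T Y(t) v] over time and the unit
    sphere, [v] is an eigenvector of [Y(t)], so the differential equation gives
    this function a positive time derivative once [L] exceeds the size of [F]. *)
Lemma psd_invariant (T phi : R) n (Y F W : R -> 'M[R]_n) :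
  mx_cont `[0, T] Y ->
  (forall t, 0 < t < T -> mx_deriv t Y (F t *m Y t + Y t *m (F t)^T + W t)) ->
  (forall t, 0 < t < T -> l1norm (F t) <= phi) ->
  (forall t, 0 <= t <= T -> (Y t)^T = Y t) ->
  (forall t, 0 < t < T -> psd (W t)) ->
  psd (Y 0) ->
  forall t, 0 <= t <= T -> psd (Y t).
Proof.
move=> cY dY Fphi Ys Wp Y0.
(* The equation holds on the open interval, so a minimum at [T] is excluded by
   stopping at [t1 < T]; the case of [T] follows by continuity. *)
have interior t1 : 0 <= t1 < T -> psd (Y t1).
  move=> /andP[t10 t1T] w; rewrite leNgt; apply/negP => w_neg.
  have w_gt0 : 0 < sqnorm w.
    rewrite lt_neqAle sqnorm_ge0 andbT eq_sym; apply/eqP => /sqnorm_eq0 w0.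
    by move: w_neg; rewrite w0 /bform mulmx0 mxE ltxx.
  pose L := 2 * phi + 1.
  pose f (p : R * 'rV[R]_n) := expR (- L * p.1) * bform (Y p.1) p.2^T p.2^T.
  pose S := [set v : 'rV[R]_n | sqnorm v^T = 1].
  pose c := (Num.sqrt (sqnorm w))^-1.
  have c2 : c ^+ 2 * sqnorm w = 1.
    by rewrite exprVn sqr_sqrtr ?mulVf ?gt_eqF// ltW.
  have wS : S (c *: w)^T by rewrite /S/= trmxK sqnormZ.
  have cf : {within `[0, t1] `*` S, continuous f}.
    apply: withinM.
      apply: (@within_fst _ _ _ _ (fun s => expR (- L * s))).
      exact: within_expRM.
    apply: within_bform_prod => i j; apply: continuous_subspaceW (cY i j).
    by apply: subset_itvl; rewrite bnd_simp ltW.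
  have [] := @compact_EVT_min _ R f (`[0, t1] `*` S) _ _ cf.
  - exists (0, (c *: w)^T); split => //=.
    by rewrite in_itv/= lexx.
  - by apply: compact_setX; [exact: segment_compact|exact: compact_sphere].
  move=> [t v]; rewrite inE => -[/=]; rewrite in_itv/= => /andP[t0 tt1] v1 fmin.
  have fminE s u : 0 <= s <= t1 -> sqnorm u = 1 ->
      expR (- L * t) * bform (Y t) v^T v^T <= expR (- L * s) * bform (Y s) u u.
    move=> st1 u1; have := fmin (s, u^T); rewrite /f/= trmxK; apply.
    by rewrite inE; split; rewrite /S/= ?trmxK// in_itv.
  set lam := bform (Y t) v^T v^T in fminE.
  have lam_neg : lam < 0.
    have := fminE t1 (c *: w); rewrite lexx t10 sqnormZ => /(_ isT c2).
    rewrite bformZl bformZr => /le_lt_trans.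
    rewrite -(pmulr_rlt0 lam (expR_gt0 (- L * t))); apply.
    rewrite pmulr_rlt0 ?expR_gt0// mulrA -expr2 pmulr_rlt0//.
    by rewrite exprn_gt0// invr_gt0 sqrtr_gt0.
  have t_gt0 : 0 < t.
    rewrite lt_neqAle t0 andbT eq_sym; apply/eqP => t00.
    by move: lam_neg; rewrite /lam t00 ltNge Y0.
  have tT : 0 < t < T by rewrite t_gt0 (le_lt_trans tt1).
  have tT' : 0 <= t <= T by case/andP: tT => /ltW-> /ltW->.
  have Yv : Y t *m v^T = lam *: v^T.
    apply: bform_min_eigen => //; first exact: Ys.
    move=> u u1; have := fminE t u; rewrite t0 tt1 => /(_ isT u1).
    by rewrite ler_pM2l// expR_gt0.
  have := left_min_deriv_le0 t_gt0
    (is_deriveM_fun (is_derive_expRM (- L) t) (mx_deriv_bform v^T v^T (dY t tT))).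
  have : forall s, 0 <= s <= t ->
      expR (- L * t) * lam <= expR (- L * s) * bform (Y s) v^T v^T.
    by move=> s /andP[s0 st]; apply: fminE => //; rewrite s0 (le_trans st).
  move=> h /(_ h); rewrite -/lam.
  have YF : bform (Y t *m (F t)^T) v^T v^T = lam * bform (F t) v^T v^T.
    rewrite /bform -[_ *m v^T]trmxK [LHS]mxE !trmx_mul !trmxK (Ys t tT').
    by rewrite -!mulmxA Yv -!scalemxAr mxE.
  have FY : bform (F t *m Y t) v^T v^T = lam * bform (F t) v^T v^T.
    by rewrite /bform -!mulmxA Yv -!scalemxAr mxE.
  rewrite !bformD YF FY.
  have := norm_bform_sqnorm_le (F t) v^T; rewrite v1 mulr1.
  move=> /le_trans/(_ (Fphi t tT)); rewrite ler_norml => /andP[_ Fv].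
  have Wv := Wp t tT v^T.
  have -> : - L * expR (- L * t) * lam + expR (- L * t) *
     (lam * bform (F t) v^T v^T + lam * bform (F t) v^T v^T + bform (W t) v^T v^T)
     = expR (- L * t) * (- lam * (L - 2 * bform (F t) v^T v^T) + bform (W t) v^T v^T).
    by ring.
  rewrite leNgt pmulr_rgt0 ?expR_gt0// => /negP; apply.
  rewrite ltr_pwDl// mulr_gt0 ?oppr_gt0// /L; lra.
move=> t /andP[t0]; rewrite le_eqVlt => /predU1P[tE|tT]; last first.
  by apply: interior; rewrite t0.
subst t.
have [T_gt0|T0] := ltP 0 T; last first.
  by rewrite (_ : T = 0)//; apply/eqP; rewrite eq_le T0 t0.
move=> w; have cw : {within `[0, T], continuous (fun s => bform (Y s) w w)}.
  rewrite (_ : (fun _ => _) = fun s => (w^T *m Y s *m w) 0 0)//.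
  by apply: mx_contM; [apply: mx_contM => //; exact: mx_cont_cst|exact: mx_cont_cst].
have /(continuous_within_itvP _ T_gt0)[_ _ cT] := cw.
apply: (cvgr_to_ge cT).
near=> s; apply: interior; apply/andP; split.
  by apply: ltW; near: s; exact: nbhs_left_gt.
by near: s; exact: nbhs_left_lt.
Unshelve. all: by end_near. Qed.

End PsdCone.

(** * The Riccati equation *)

(** The matrix of the quadratic term, the information gained from the
    observation per unit of time. *)
Definition info (R : realType) (n m r : nat) (C : 'M[R]_(r, n))
    (S : quad R n m r) : 'M[R]_n := C^T *m invmx (obs_cov S) *m C.

(** The inhomogeneous term, the covariance of the noise entering the state. *)
Definition noise (R : realType) (n m r : nat) (B : 'M[R]_(n, m))
    (S : quad R n m r) : 'M[R]_n := B *m model_cov S *m B^T.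

Definition quad_l1_bounded (R : realType) (n m r : nat) (b : R)
    (S : quad R n m r) : Prop :=
  [/\ l1norm (drift S) <= b, l1norm (init_cov S) <= b, l1norm (model_cov S) <= b
    & l1norm (obs_cov S) <= b /\ l1norm (invmx (obs_cov S)) <= b].

Definition quad_l1_close (R : realType) (n m r : nat) (e : R)
    (S S' : quad R n m r) : Prop :=
  [/\ l1norm (drift S - drift S') <= e, l1norm (init_cov S - init_cov S') <= e,
      l1norm (model_cov S - model_cov S') <= e
    & l1norm (obs_cov S - obs_cov S') <= e].

Section Riccati.
Context {R : realType} {n m r : nat}.
Variables (T : R) (B : 'M[R]_(n, m)) (C : 'M[R]_(r, n)).
Hypothesis T_ge0 : 0 <= T.
Implicit Types (S : quad R n m r) (P : R -> 'M[R]_n) (s t : R).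

Lemma bform_congr p (M : 'M[R]_p) (N : 'M[R]_(n, p)) u v :
  bform (N *m M *m N^T) u v = bform M (N^T *m u) (N^T *m v).
Proof. by rewrite /bform trmx_mul trmxK !mulmxA. Qed.

Lemma psd_congr p (M : 'M[R]_p) (N : 'M[R]_(n, p)) :
  psd M -> psd (N *m M *m N^T).
Proof. by move=> Mp v; rewrite bform_congr. Qed.

Lemma posdef_invmx_sym p (M : 'M[R]_p) : posdef M -> (invmx M)^T = invmx M.
Proof. by move=> [Ms _]; rewrite trmx_inv Ms. Qed.

Lemma posdef_invmx_psd p (M : 'M[R]_p) : posdef M -> psd (invmx M).
Proof.
move=> Mp v; have := posdef_psd Mp (invmx M *m v).
rewrite /bform trmx_mul (posdef_invmx_sym Mp) -!mulmxA mulKVmx//.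
exact: posdef_unitmx.
Qed.

Lemma info_sym S : admissible S -> (info C S)^T = info C S.
Proof.
by move=> [_ _ Qp]; rewrite /info !trmx_mul trmxK (posdef_invmx_sym Qp) mulmxA.
Qed.

Lemma info_psd S : admissible S -> psd (info C S).
Proof.
move=> [_ _ Qp]; rewrite /info -{2}(trmxK C); apply: psd_congr.
exact: posdef_invmx_psd.
Qed.

Lemma noise_psd S : admissible S -> psd (noise B S).
Proof. by move=> [_ Wp _]; apply: psd_congr; exact: posdef_psd. Qed.

Definition riccati_rhs S (X : 'M[R]_n) : 'M[R]_n :=
  drift S *m X + X *m (drift S)^T - X *m info C S *m X + noise B S.

Lemma riccati_mx_cont S P : riccati_solution T B C S P -> mx_cont `[0, T] P.
Proof. by move=> [_ cP _]; exact: mx_cont_within. Qed.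

Lemma riccati_mx_deriv S P t : riccati_solution T B C S P -> 0 < t < T ->
  mx_deriv t P (riccati_rhs S (P t)).
Proof.
move=> [_ _ dP] tT; apply: is_derive_mx_deriv; have := dP t tT.
by rewrite /riccati_rhs /info /noise !mulmxA.
Qed.

(** Each summand has one factor that is a difference, so the quadratic term is
    Lipschitz in [X] and [K] on bounded sets. *)
Lemma quad_term_sub (X X' K K' : 'M[R]_n) :
  X *m K *m X - X' *m K' *m X' =
  (X - X') *m K *m X + X' *m (K - K') *m X + X' *m K' *m (X - X').
Proof.
rewrite !(mulmxDl, mulmxDr, mulmxN, mulNmx).
move: (X *m K *m X) (X' *m K *m X) (X' *m K' *m X) (X' *m K' *m X') => a b c d.
by apply/matrixP => i j; rewrite !mxE; ring.
Qed.

(** [P - P^T] solves a homogeneous linear equation with zero initial value. *)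
Lemma riccati_sym S P : admissible S -> riccati_solution T B C S P ->
  forall t, 0 <= t <= T -> (P t)^T = P t.
Proof.
move=> Sa SP; have cP := riccati_mx_cont SP.
have [M M0 PM] := mx_cont_bounded T_ge0 cP.
set a := l1norm (drift S); set k := l1norm (info C S).
pose Z t := P t - (P t)^T.
have k0 : 0 <= k by exact: l1norm_ge0.
have a0 : 0 <= a by exact: l1norm_ge0.
have c0 : 0 <= 2 * a + 2 * (M * k) by rewrite addr_ge0// !mulr_ge0.
have dZ t : 0 < t < T ->
    mx_deriv t Z (riccati_rhs S (P t) - (riccati_rhs S (P t))^T).
  move=> tT.
  by apply: mx_derivB; [|apply: mx_deriv_tr]; exact: riccati_mx_deriv.
have noise_sym : (noise B S)^T = noise B S.
  by case: Sa => _ [Ws _] _; rewrite /noise !trmx_mul trmxK Ws mulmxA.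
have bZ t : 0 < t < T -> l1norm (riccati_rhs S (P t) - (riccati_rhs S (P t))^T)
    <= (2 * a + 2 * (M * k)) * l1norm (Z t) + 0.
  move=> /andP[/ltW t0 /ltW tT]; have PMt : l1norm (P t) <= M by rewrite PM ?t0.
  have -> : riccati_rhs S (P t) - (riccati_rhs S (P t))^T =
      drift S *m Z t + Z t *m (drift S)^T
      - (P t *m info C S *m Z t + Z t *m info C S *m (P t)^T).
    have PKP : (P t *m info C S *m P t)^T = (P t)^T *m info C S *m (P t)^T.
      by rewrite trmx_mul [(_ *m info C S)^T]trmx_mul (info_sym Sa) mulmxA.
    rewrite /riccati_rhs !linearD/= linearN/= noise_sym PKP.
    rewrite [(drift S *m P t)^T]trmx_mul.
    rewrite [(P t *m (drift S)^T)^T]trmx_mul trmxK.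
    rewrite /Z !(mulmxDl, mulmxDr, mulmxN, mulNmx).
    move: (drift S *m P t) (P t *m (drift S)^T) (drift S *m (P t)^T)
      ((P t)^T *m (drift S)^T) (P t *m info C S *m P t)
      (P t *m info C S *m (P t)^T) ((P t)^T *m info C S *m (P t)^T) (noise B S).
    move=> ? ? ? ? ? ? ? ?; apply/matrixP => i j; rewrite !mxE; ring.
  have -> : (2 * a + 2 * (M * k)) * l1norm (Z t) + 0 =
      (a * l1norm (Z t) + l1norm (Z t) * a) +
      (M * k * l1norm (Z t) + l1norm (Z t) * k * M) by ring.
  apply: l1normB_le; apply: l1normD_le; apply: l1normM_le => //.
  - by rewrite l1norm_tr.
  - exact: l1normM_le.
  - exact: l1normM_le.
  - by rewrite l1norm_tr.
have cZ : mx_cont `[0, T] Z by apply: mx_contB => //; exact: mx_cont_tr.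
have Z0 : l1norm (Z 0) <= 0.
  case: Sa SP => -[Gs _] _ _ [P0 _ _].
  by rewrite /Z P0 Gs subrr l1norm0.
move=> t tT; have := mx_gronwall T_ge0 c0 (lexx 0) (lexx 0) cZ dZ bZ Z0 tT.
rewrite addr0 mulr0 => Zt; apply/matrixP => i j; rewrite mxE.
apply/esym/eqP; rewrite -subr_eq0 -normr_le0.
by apply: le_trans Zt; have := entry_le_l1norm (Z t) i j; rewrite !mxE.
Qed.

(** Applied to [P - d exp(- L t) 1], the invariance of the cone bounds [P] from
    below; with [F = A - P K / 2], the Riccati equation has the required
    form. *)
Lemma riccati_coercive S P : admissible S -> riccati_solution T B C S P ->
  exists2 c, 0 <= c &
    forall t, 0 <= t <= T -> forall v, sqnorm v <= c * bform (P t) v v.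
Proof.
move=> Sa SP; have cP := riccati_mx_cont SP; have Ps := riccati_sym Sa SP.
have [M M0 PM] := mx_cont_bounded T_ge0 cP.
have [P0 _ _] := SP; have [Gp _ _] := Sa.
(* The form [init_cov S] dominates [g^-1 |v|^2]; the [1] keeps [g] positive in
   dimension 0. *)
pose g := l1norm (invmx (init_cov S)) + 1.
have g0 : 0 < g by rewrite ltr_wpDl// l1norm_ge0.
pose phi := l1norm (drift S) + 2^-1 * (M * l1norm (info C S)).
pose L := 2 * phi.
have phi0 : 0 <= phi by rewrite addr_ge0 ?l1norm_ge0// !mulr_ge0 ?l1norm_ge0.
pose F t := drift S - 2^-1 *: (P t *m info C S).
pose d t := g^-1 * expR (- L * t).
pose Y t := P t - d t *: 1%:M.
(* The scalar part of [W] absorbs [F + F^T], since [L] is twice a bound for [F]. *)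
pose W t := noise B S + d t *: (L *: 1%:M + F t + (F t)^T).
have d0 t : 0 < d t by rewrite mulr_gt0 ?expR_gt0 ?invr_gt0.
have cd : {within `[0, T], continuous d}.
  by apply: withinM; [exact: within_cst|exact: within_expRM].
have cY : mx_cont `[0, T] Y.
  by apply: mx_contB => //; apply: mx_contZ => //; exact: mx_cont_cst.
have dd t : is_derive t 1 d (- L * d t).
  have := is_deriveZ (g^-1) (is_derive_expRM (- L) t).
  by rewrite /GRing.scale/= mulrCA.
have dY t : 0 < t < T -> mx_deriv t Y (F t *m Y t + Y t *m (F t)^T + W t).
  move=> tT; have tT' : 0 <= t <= T by case/andP: tT => /ltW-> /ltW->.
  have -> : F t *m Y t + Y t *m (F t)^T + W t =
      riccati_rhs S (P t) - (- L * d t) *: 1%:M.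
    have FP : F t *m P t =
        drift S *m P t - 2^-1 *: (P t *m info C S *m P t).
      by rewrite mulmxBl -scalemxAl.
    have PF : P t *m (F t)^T =
        P t *m (drift S)^T - 2^-1 *: (P t *m info C S *m P t).
      rewrite linearB linearZ/= [(_ *m info C S)^T]trmx_mul (info_sym Sa).
      rewrite (Ps _ tT').
      by rewrite mulmxBr -scalemxAr mulmxA.
    rewrite /riccati_rhs /W /Y; move: (F t) FP PF => f FP PF.
    rewrite !(mulmxDl, mulmxDr, mulmxN, mulNmx) FP PF.
    rewrite -!scalemxAl -!scalemxAr mulmx1 mul1mx.
    move: (drift S *m P t) (P t *m (drift S)^T) (P t *m info C S *m P t)
      (noise B S) f^T (1%:M : 'M[R]_n) => ? ? ? ? ? ?.
    by apply/matrixP => i j; rewrite !mxE; field.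
  apply: mx_derivB; first exact: riccati_mx_deriv.
  move=> i j; rewrite mxE.
  apply: (@is_derive_eq_fun _ (fun s => (1%:M : 'M[R]_n) i j * d s)).
    by apply/funext => s; rewrite !mxE mulrC.
  by rewrite mulrC; exact: (is_deriveZ _ (dd t)).
have Fphi t : 0 <= t <= T -> l1norm (F t) <= phi.
  move=> tT; apply: l1normB_le => //.
  rewrite l1normZ ger0_norm ?invr_ge0//.
  by rewrite ler_wpM2l ?invr_ge0//; apply: l1normM_le => //; exact: PM.
have Ysym t : 0 <= t <= T -> (Y t)^T = Y t.
  by move=> tT; rewrite linearB linearZ/= trmx1 (Ps _ tT).
have Wp t : 0 < t < T -> psd (W t).
  move=> tT v; have tT' : 0 <= t <= T by case/andP: tT => /ltW-> /ltW->.
  rewrite bformD bformZ [bform (_ + (F t)^T) v v]bformD.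
  rewrite [bform (_ + F t) v v]bformD bformZ bform1.
  have -> : bform (F t)^T v v = bform (F t) v v.
    by rewrite /bform -[_ *m v]trmxK [LHS]mxE !trmx_mul !trmxK mulmxA.
  rewrite addr_ge0 ?noise_psd// mulr_ge0// ?(ltW (d0 _))//.
  have := norm_bform_sqnorm_le (F t) v; have := Fphi t tT'.
  have := sqnorm_ge0 v; rewrite ler_norml => v0 Ft /andP[Fv _].
  have : l1norm (F t) * sqnorm v <= phi * sqnorm v by rewrite ler_wpM2r.
  rewrite /L; lra.
have Y0 : psd (Y 0).
  move=> v; rewrite bformB bformZ bform1 P0 /d mulr0 expR0 mulr1.
  rewrite subr_ge0 ler_pdivrMl//; apply: le_trans (posdef_coercive v Gp) _.
  by rewrite ler_wpM2r ?posdef_psd// lerDl.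
have Fphi' t : 0 < t < T -> l1norm (F t) <= phi.
  by move=> /andP[/ltW t0 /ltW tT]; apply: Fphi; rewrite t0.
have Yp := psd_invariant cY dY Fphi' Ysym Wp Y0.
exists (g * expR (L * T)).
  by rewrite mulr_ge0 ?expR_ge0// ltW.
move=> t tT v; have := Yp t tT v; rewrite bformB bformZ bform1 subr_ge0 => h.
have L0 : 0 <= L by rewrite mulr_ge0.
have dTt : d T <= d t.
  rewrite /d ler_wpM2l ?invr_ge0 ?(ltW g0)// ler_expR !mulNr lerN2 ler_wpM2l//.
  by case/andP: tT.
have h' : d T * sqnorm v <= bform (P t) v v.
  by apply: le_trans h; rewrite ler_wpM2r ?sqnorm_ge0.
have -> : g * expR (L * T) = (d T)^-1.
  by rewrite /d invfM invrK mulNr expRN invrK.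
by rewrite -ler_pdivrMl ?invr_gt0// invrK.
Qed.

(** The Gronwall bound for the trace, times the factor [n * n] by which the
    trace controls the norm. *)
Definition riccati_bound (b : R) : R :=
  (n * n)%:R * ((b + l1norm B * b * l1norm B * T)
    * expR (2 * b * (n * n)%:R * T)).

(** The quadratic term only lowers the trace, which controls the norm on the
    positive semidefinite cone. *)
Lemma riccati_le b S P : 0 <= b -> admissible S -> quad_l1_bounded b S ->
  riccati_solution T B C S P ->
  forall t, 0 <= t <= T -> l1norm (P t) <= riccati_bound b.
Proof.
move=> b0 Sa [Ab Gb Wb _] SP; have Ps := riccati_sym Sa SP.
have cP := riccati_mx_cont SP; have [P0 _ _] := SP.
have Pp t : 0 <= t <= T -> psd (P t).
  have [c c0 Pc] := riccati_coercive Sa SP.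
  move=> tT v; have := Pc t tT v; have := sqnorm_ge0 v => v0 /(le_trans v0).
  have [c_gt0|c_le0 _] := ltP 0 c; first by rewrite pmulr_rge0.
  have cE : c = 0 by apply/eqP; rewrite eq_le c_le0.
  have := Pc t tT v; rewrite cE mul0r.
  move=> v0'; rewrite (_ : v = 0) ?/bform ?mulmx0 ?mxE//.
  by apply: sqnorm_eq0; apply/eqP; rewrite eq_le v0 v0'.
pose N : R := (n * n)%:R.
have tr_l1 (X : 'M[R]_n) : `|\tr X| <= l1norm X.
  apply: le_trans (ler_norm_sum _ _ _) _; apply: ler_sum => i _.
  by rewrite (bigD1 i)//= lerDl sumr_ge0.
pose w := l1norm B * b * l1norm B.
have w0 : 0 <= w by rewrite !mulr_ge0 ?l1norm_ge0.
have ctr : {within `[0, T], continuous (fun t => \tr (P t))}.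
  exact: (@within_sum _ _ _ _ (fun i t => P t i i)).
have dtr t : 0 < t < T ->
    is_derive t 1 (fun t => \tr (P t)) (\tr (riccati_rhs S (P t))).
  move=> tT; apply: (@is_derive_sum_fun _ _ (fun i t => P t i i)) => i.
  exact: riccati_mx_deriv.
have dle t : 0 < t < T -> \tr (riccati_rhs S (P t)) <= 2 * b * N * \tr (P t) + w.
  move=> /andP[/ltW t0 /ltW tT]; have tT' : 0 <= t <= T by rewrite t0.
  rewrite /riccati_rhs !mxtraceD linearN/=.
  have PN : l1norm (P t) <= N * \tr (P t).
    by apply: psd_l1norm_trace; [exact: Ps|exact: Pp].
  have h1 : \tr (drift S *m P t) <= b * (N * \tr (P t)).
    apply: le_trans (ler_norm _) _; apply: le_trans (tr_l1 _) _.
    exact: l1normM_le.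
  have h2 : \tr (P t *m (drift S)^T) <= (N * \tr (P t)) * b.
    apply: le_trans (ler_norm _) _; apply: le_trans (tr_l1 _) _.
    by apply: l1normM_le; rewrite ?l1norm_tr.
  have h3 : 0 <= \tr (P t *m info C S *m P t).
    apply: sumr_ge0 => i _; apply: psd_diag_ge0.
    by rewrite -{2}(Ps t tT'); apply: psd_congr; exact: info_psd.
  have h4 : \tr (noise B S) <= w.
    apply: le_trans (ler_norm _) _; apply: le_trans (tr_l1 _) _.
    by apply: l1normM_le; [exact: l1normM_le|rewrite l1norm_tr].
  lra.
have a0 : 0 <= 2 * b * N by rewrite !mulr_ge0.
move=> t tT; have := gronwall a0 w0 ctr dtr dle tT => h.
apply: le_trans (psd_l1norm_trace (Ps t tT) (Pp t tT)) _.
rewrite /riccati_bound ler_wpM2l//; apply: le_trans h _.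
have /andP[t0 tT'] := tT.
rewrite ler_pM ?expR_ge0//.
- apply: addr_ge0; last exact: mulr_ge0.
  by apply: sumr_ge0 => i _; apply: psd_diag_ge0; apply: Pp; rewrite lexx.
- rewrite lerD//.
    by rewrite P0; apply: le_trans (le_trans (ler_norm _) (tr_l1 _)) Gb.
  by rewrite ler_wpM2l.
- by rewrite ler_expR ler_wpM2l.
Qed.

Lemma invmx_sub p (M N : 'M[R]_p) : M \in unitmx -> N \in unitmx ->
  invmx M - invmx N = invmx M *m (N - M) *m invmx N.
Proof.
by move=> Mu Nu; rewrite mulmxBr mulmxBl mulmxK// mulVmx// mul1mx.
Qed.

Lemma obs_inv_close b e S S' : admissible S -> admissible S' ->
  quad_l1_bounded b S -> quad_l1_bounded b S' -> quad_l1_close e S S' ->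
  l1norm (invmx (obs_cov S) - invmx (obs_cov S')) <= b * e * b.
Proof.
move=> [_ _ Qp] [_ _ Q'p] [_ _ _ [_ Qb]] [_ _ _ [_ Q'b]] [_ _ _ Qe].
rewrite invmx_sub; [|exact: posdef_unitmx..].
by apply: l1normM_le => //; apply: l1normM_le => //; rewrite -opprB l1normN.
Qed.

Definition riccati_lip (b M : R) : R :=
  let k := l1norm C * b * l1norm C in
  growth (2 * b + 2 * (M * k)) T n n *
  (1 + (2 * M + M * (l1norm C * (b * b) * l1norm C) * M + l1norm B * l1norm B)).

(** The difference of two solutions satisfies a linear differential inequality
    whose inhomogeneous term is proportional to the distance of the data. *)
Lemma riccati_close b M e S S' P P' : 0 <= b -> 0 <= M -> 0 <= e ->
  admissible S -> admissible S' ->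
  quad_l1_bounded b S -> quad_l1_bounded b S' -> quad_l1_close e S S' ->
  riccati_solution T B C S P -> riccati_solution T B C S' P' ->
  (forall t, 0 <= t <= T -> l1norm (P t) <= M) ->
  (forall t, 0 <= t <= T -> l1norm (P' t) <= M) ->
  forall t, 0 <= t <= T -> l1norm (P t - P' t) <= riccati_lip b M * e.
Proof.
move=> b0 M0 e0 Sa Sa' Sb Sb' Sc SP SP' PM P'M.
have Qe := obs_inv_close Sa Sa' Sb Sb' Sc.
have [Ab Gb Wb [_ Qb]] := Sb; have [Ab' Gb' Wb' [_ Qb']] := Sb'.
have [Ae Ge We _] := Sc.
pose k := l1norm C * b * l1norm C.
have k0 : 0 <= k by rewrite !mulr_ge0 ?l1norm_ge0.
have Kk : l1norm (info C S) <= k.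
  by apply: l1normM_le => //; apply: l1normM_le => //; rewrite l1norm_tr.
have Kk' : l1norm (info C S') <= k.
  by apply: l1normM_le => //; apply: l1normM_le => //; rewrite l1norm_tr.
have Ke : l1norm (info C S - info C S') <= l1norm C * (b * e * b) * l1norm C.
  rewrite /info -mulmxBl -mulmxBr.
  by apply: l1normM_le => //; apply: l1normM_le => //; rewrite l1norm_tr.
have Ne : l1norm (noise B S - noise B S') <= l1norm B * e * l1norm B.
  rewrite /noise -mulmxBl -mulmxBr.
  by apply: l1normM_le; [exact: l1normM_le|rewrite l1norm_tr].
pose Z t := P t - P' t.
pose c := 2 * M + M * (l1norm C * (b * b) * l1norm C) * M + l1norm B * l1norm B.
have c0 : 0 <= c by rewrite !addr_ge0// !mulr_ge0// l1norm_ge0.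
have a0 : 0 <= 2 * b + 2 * (M * k) by have := mulr_ge0 M0 k0; lra.
have cZ : mx_cont `[0, T] Z.
  by apply: mx_contB; [exact: riccati_mx_cont SP|exact: riccati_mx_cont SP'].
have dZ t : 0 < t < T ->
    mx_deriv t Z (riccati_rhs S (P t) - riccati_rhs S' (P' t)).
  by move=> tT; apply: mx_derivB; exact: riccati_mx_deriv.
have bZ t : 0 < t < T -> l1norm (riccati_rhs S (P t) - riccati_rhs S' (P' t))
    <= (2 * b + 2 * (M * k)) * l1norm (Z t) + c * e.
  move=> /andP[/ltW t0 /ltW tT].
  have PMt : l1norm (P t) <= M by rewrite PM ?t0.
  have P'Mt : l1norm (P' t) <= M by rewrite P'M ?t0.
  have -> : riccati_rhs S (P t) - riccati_rhs S' (P' t) =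
      (drift S *m Z t + (drift S - drift S') *m P' t)
      + (Z t *m (drift S)^T + P' t *m (drift S - drift S')^T)
      - (Z t *m info C S *m P t + P' t *m (info C S - info C S') *m P t
         + P' t *m info C S' *m Z t)
      + (noise B S - noise B S').
    rewrite /Z -quad_term_sub /riccati_rhs [(drift S - drift S')^T]linearB/=.
    rewrite !(mulmxBl (drift _), mulmxBr (drift _)).
    rewrite !(mulmxBl (P t), mulmxBr (P' t)).
    move: (drift S *m P t) (P t *m (drift S)^T) (drift S' *m P' t)
      (P' t *m (drift S')^T) (drift S *m P' t) (P' t *m (drift S)^T)
      (P t *m info C S *m P t) (P' t *m info C S' *m P' t) (noise B S) (noise B S').
    by move=> ? ? ? ? ? ? ? ? ? ?; apply/matrixP => i j; rewrite !mxE; ring.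
  have -> : (2 * b + 2 * (M * k)) * l1norm (Z t) + c * e =
     (b * l1norm (Z t) + e * M) + (l1norm (Z t) * b + M * e)
     + (l1norm (Z t) * k * M + M * (l1norm C * (b * e * b) * l1norm C) * M
        + M * k * l1norm (Z t))
     + l1norm B * e * l1norm B by rewrite /c; ring.
  apply: l1normD_le => //; apply: l1normB_le.
    apply: l1normD_le; apply: l1normD_le; apply: l1normM_le => //;
      by rewrite l1norm_tr.
  by apply: l1normD_le; [apply: l1normD_le|]; apply: l1normM_le => //;
    exact: l1normM_le.
have Z0 : l1norm (Z 0) <= e.
  by case: SP SP' => [P0 _ _] [P'0 _ _]; rewrite /Z P0 P'0.
have ce0 : 0 <= c * e by rewrite mulr_ge0.
move=> t tT; have := mx_gronwall T_ge0 a0 ce0 e0 cZ dZ bZ Z0 tT.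
by rewrite /riccati_lip -/k -/c -mulrA [(1 + c) * e]mulrDl mul1r.
Qed.

End Riccati.

(** * The filter equation *)

Section IntegrableFun.
Context {R : realType} {d} {X : measurableType d}.
Context {mu : {measure set X -> \bar R}} {D : set X}.
Hypothesis mD : measurable D.
Implicit Types (f g : X -> R).

Lemma integrableD_fun f g : mu.-integrable D (EFin \o f) ->
  mu.-integrable D (EFin \o g) -> mu.-integrable D (EFin \o (fun s => f s + g s)).
Proof. by move=> fi gi; have := integrableD mD fi gi; apply: eq_integrable. Qed.

Lemma integrableB_fun f g : mu.-integrable D (EFin \o f) ->
  mu.-integrable D (EFin \o g) -> mu.-integrable D (EFin \o (fun s => f s - g s)).
Proof. by move=> fi gi; have := integrableB mD fi gi; apply: eq_integrable. Qed.

Lemma integrableZ_fun a f : mu.-integrable D (EFin \o f) ->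
  mu.-integrable D (EFin \o (fun s => a * f s)).
Proof. by move=> fi; have := integrableZl mD a fi; apply: eq_integrable. Qed.

Lemma integrable_norm_fun f : mu.-integrable D (EFin \o f) ->
  mu.-integrable D (EFin \o (fun s => `|f s|)).
Proof. by move=> fi; have := integrable_abse fi; apply: eq_integrable. Qed.

End IntegrableFun.

Section IntegralGronwall.
Context {R : realType}.
Notation mu := (@lebesgue_measure R).
Implicit Types (s t : R) (f g : R -> R).

Lemma within_integrable (T : R) g : {within `[0, T], continuous g} ->
  mu.-integrable `[0, T] (EFin \o g).
Proof.
by move=> cg; apply: continuous_compact_integrable => //; exact: segment_compact.
Qed.

Lemma integrable_itvS (T t : R) (g : R -> R) : t <= T ->
  mu.-integrable `[0, T] (EFin \o g) -> mu.-integrable `[0, t] (EFin \o g).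
Proof.
by move=> tT; apply: integrableS => //; apply: subset_itvl; rewrite bnd_simp.
Qed.

(** For continuous [g], the primitive of [g] satisfies a differential
    inequality. *)
Lemma integral_gronwall (T a b : R) g : 0 <= a -> 0 <= b ->
  {within `[0, T], continuous g} ->
  (forall t, 0 <= t <= T -> g t <= a * \int[mu]_(s in `[0, t]) g s + b) ->
  forall t, 0 <= t <= T -> g t <= (1 + a * T * expR (a * T)) * b.
Proof.
move=> a0 b0 cg gle t tT; have /andP[t0 tT'] := tT.
have T0 : 0 <= T := le_trans t0 tT'.
have ig := within_integrable cg.
pose G s := \int[mu]_(u in `[0, s]) g u.
have cG : {within `[0, T], continuous G}.
  exact: parameterized_integral_continuous.
have dG s : 0 < s < T -> is_derive s 1 G (g s).
  move=> /andP[s0 sT].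
  have /(continuous_within_itvP _ (lt_trans s0 sT))[cgo _ _] := cg.
  have cgs : {for s, continuous g} by apply: cgo; rewrite in_itv/= s0.
  have [d1 d2] := continuous_FTC1_closed sT ig s0 cgs.
  by split; [exact: d1|rewrite -derive1E].
have Gle s : 0 < s < T -> g s <= a * G s + b.
  by move=> /andP[/ltW s0 /ltW sT]; apply: gle; rewrite s0.
have := gronwall a0 b0 cG dG Gle tT.
have -> : G 0 = 0 by rewrite /G set_itv1 Rintegral_set1.
rewrite add0r => Gt; apply: le_trans (gle t tT) _.
have : G t <= b * T * expR (a * T).
  apply: le_trans Gt _; rewrite ler_pM ?mulr_ge0 ?expR_ge0//.
    by rewrite ler_wpM2l.
  by rewrite ler_expR ler_wpM2l.
rewrite -/(G t) => {}Gt; have := ler_wpM2l a0 Gt; lra.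
Qed.

End IntegralGronwall.

Section FilterIntegrability.
Context {R : realType} {r : nat}.
Notation mu := (@lebesgue_measure R).
Variables (T : R) (y : R -> 'cV[R]_r).
Hypothesis hy : square_integrable T y.

(** An integrable function dominating [y], whose square is what is assumed to
    be integrable. *)
Definition obs_weight (s : R) : R := 1 + enorm (y s) ^+ 2.

Lemma integrable_obs_weight : mu.-integrable `[0, T] (EFin \o obs_weight).
Proof.
have [my ley] := hy.
have msq : measurable_fun `[0, T] (fun s => enorm (y s) ^+ 2).
  rewrite (_ : (fun _ => _) = fun s => \sum_i y s i 0 ^+ 2); last first.
    by apply/funext => s; rewrite enorm_sqr.
  by apply: measurable_sum => i; apply: measurable_funX; exact: my.
rewrite (_ : _ \o _ =
    (cst 1%:E) \+ (EFin \o (fun s => enorm (y s) ^+ 2))); last first.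
  by apply/funext => s; rewrite /= EFinD.
apply: integrableD => //.
  by apply: (@within_integrable _ T (cst 1)); exact: within_cst.
apply/integrableP; split; first exact/measurable_EFinP.
apply: le_lt_trans ley; rewrite le_eqVlt; apply/orP; left; apply/eqP.
by apply: eq_integral => s _; rewrite /= ger0_norm// sqr_ge0.
Qed.

Lemma entry_le_obs_weight s i : `|y s i 0| <= obs_weight s.
Proof.
apply: le_trans (entry_le_enorm _ _) _; rewrite /obs_weight.
have := sqr_ge0 (enorm (y s) - 1); have := sqr_ge0 (enorm (y s)).
have : 0 <= enorm (y s) by exact: sqrtr_ge0.
nra.
Qed.

Lemma integrable_obs i : mu.-integrable `[0, T] (EFin \o (fun s => y s i 0)).
Proof.
have [my _] := hy; apply: le_integrable integrable_obs_weight => //.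
  by apply/measurable_EFinP; exact: my.
move=> s _ /=; rewrite lee_fin; apply: le_trans (entry_le_obs_weight s i) _.
exact: ler_norm.
Qed.

Lemma integrable_sum_fun n (f : 'I_n -> R -> R) :
  (forall i, mu.-integrable `[0, T] (EFin \o f i)) ->
  mu.-integrable `[0, T] (EFin \o (fun s => \sum_i f i s)).
Proof.
move=> fi; rewrite (_ : _ \o _ = fun s => (\sum_i (f i s)%:E)%E); last first.
  by apply/funext => s; rewrite /= sumEFin.
by apply: integrable_sum => // i _; exact: fi.
Qed.

Lemma integrable_withinM (g f : R -> R) : {within `[0, T], continuous g} ->
  mu.-integrable `[0, T] (EFin \o f) ->
  mu.-integrable `[0, T] (EFin \o (fun s => g s * f s)).
Proof.
move=> cg fi.
have -> : EFin \o (fun s => g s * f s) = ((EFin \o g) \* (EFin \o f))%E.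
  by apply/funext => s; rewrite /= EFinM.
apply: integrableMr => //.
  exact: subspace_continuous_measurable_fun.
have /compact_bounded[M [Mreal Mg]] :=
  continuous_compact cg (@segment_compact _ 0 T).
exists M; split => // x xM s sT /=; apply: Mg => //.
Qed.

(** A continuous function plus continuous multiples of the components of [y]. *)
Lemma integrable_filter_rhs n m (C : 'M[R]_(r, n)) (S : quad R n m r)
    (P : R -> 'M[R]_n) (x : R -> 'cV[R]_n) i :
  mx_cont `[0, T] P -> mx_cont `[0, T] x ->
  mu.-integrable `[0, T]
    (EFin \o (fun s => filter_rhs C S (P s) (y s) (x s) i 0)).
Proof.
move=> cP cx.
pose G s := P s *m C^T *m invmx (obs_cov S).
have cG : mx_cont `[0, T] G.
  by apply: mx_contM; [apply: mx_contM => //|]; exact: mx_cont_cst.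
pose h s := drift S *m x s - G s *m (C *m x s).
have ch : mx_cont `[0, T] h.
  apply: mx_contB; first by apply: mx_contM => //; exact: mx_cont_cst.
  by apply: mx_contM => //; apply: mx_contM => //; exact: mx_cont_cst.
rewrite (_ : _ \o _ = ((EFin \o (fun s => h s i 0)%R) \+
    (EFin \o (fun s => \sum_k G s i k * y s k 0)%R))%E); last first.
  apply/funext => s /=; rewrite -EFinD; congr (_%:E).
  have -> : \sum_k G s i k * y s k 0 = (G s *m y s) i 0 by rewrite mxE.
  rewrite /filter_rhs -/(G s) /h mulmxBr.
  move: (drift S *m x s) (G s *m (C *m x s)) (G s *m y s) => u v w.
  by rewrite !mxE; ring.
apply: integrableD => //; first exact: within_integrable.
apply: integrable_sum_fun => k; apply: integrable_withinM => //.
exact: integrable_obs.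
Qed.

End FilterIntegrability.

Section FilterStability.
Context {R : realType} {n m r : nat}.
Notation mu := (@lebesgue_measure R).
Variables (T : R) (C : 'M[R]_(r, n)) (x0 : 'cV[R]_n) (y : R -> 'cV[R]_r).
Hypothesis hy : square_integrable T y.
Implicit Types (S : quad R n m r) (P : R -> 'M[R]_n) (x : R -> 'cV[R]_n).

Lemma filter_rhs_sub S S' (X X' : 'M[R]_n) (v : 'cV[R]_r) (z z' : 'cV[R]_n) :
  let G := X *m C^T *m invmx (obs_cov S) in
  let G' := X' *m C^T *m invmx (obs_cov S') in
  filter_rhs C S X v z - filter_rhs C S' X' v z' =
  (drift S - G *m C) *m (z - z') + (drift S - drift S') *m z'
  + (G - G') *m (v - C *m z').
Proof.
move=> G G'; rewrite /filter_rhs -/G -/G'.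
rewrite !(mulmxDl, mulmxDr, mulmxN, mulNmx) !mulmxA.
move: (drift S *m z) (drift S *m z') (drift S' *m z') (G *m v) (G' *m v)
  (G *m C *m z) (G *m C *m z') (G' *m C *m z') => ? ? ? ? ? ? ? ?.
by apply/matrixP => i j; rewrite !mxE; ring.
Qed.

(** Bounds for the two parts of the difference of the right-hand sides: the
    factor of the difference of the states, and the part caused by the data
    ([L] is a Lipschitz constant for the Riccati solution, [X] a bound for the
    reference state). *)
Definition filter_rate (b M : R) : R := b + M * l1norm C * b * l1norm C.

Definition filter_defect (b M L X : R) : R :=
  X + (L * l1norm C * b + M * l1norm C * (b * b)) * (r%:R + l1norm C * X).

Lemma l1norm_obs s : l1norm (y s) <= r%:R * obs_weight y s.
Proof.
rewrite -[in r%:R](muln1 r); apply: l1norm_le_entries => i j; rewrite ord1.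
exact: entry_le_obs_weight.
Qed.

Lemma obs_weight_ge1 s : 1 <= obs_weight y s.
Proof. by rewrite lerDl sqr_ge0. Qed.

Lemma filter_rhs_close b M L X e S S' (P P' : 'M[R]_n) s (z z' : 'cV[R]_n) :
  0 <= b -> 0 <= M -> 0 <= L -> 0 <= X -> 0 <= e ->
  quad_l1_bounded b S -> quad_l1_bounded b S' -> quad_l1_close e S S' ->
  l1norm (invmx (obs_cov S) - invmx (obs_cov S')) <= b * e * b ->
  l1norm P <= M -> l1norm P' <= M -> l1norm (P - P') <= L * e ->
  l1norm z' <= X ->
  l1norm (filter_rhs C S P (y s) z - filter_rhs C S' P' (y s) z') <=
  filter_rate b M * l1norm (z - z') + filter_defect b M L X * e * obs_weight y s.
Proof.
move=> b0 M0 L0 X0 e0 [Ab _ _ [_ Qb]] [_ _ _ [_ Qb']] [Ae _ _ _] Qe.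
move=> PM P'M PL z'X.
rewrite filter_rhs_sub; set G := _ *m invmx (obs_cov S).
set G' := _ *m invmx (obs_cov S').
have c0 : 0 <= l1norm C by exact: l1norm_ge0.
have GM : l1norm G <= M * l1norm C * b.
  by apply: l1normM_le => //; apply: l1normM_le; rewrite ?l1norm_tr.
have GG : l1norm (G - G') <= L * e * l1norm C * b + M * l1norm C * (b * e * b).
  have -> : G - G' = (P - P') *m C^T *m invmx (obs_cov S) +
      P' *m C^T *m (invmx (obs_cov S) - invmx (obs_cov S')).
    by rewrite !mulmxBl mulmxBr addrA subrK.
  apply: l1normD_le; apply: l1normM_le => //;
    by apply: l1normM_le; rewrite ?l1norm_tr.
have w1 := obs_weight_ge1 s; set w := obs_weight y s in w1 *.
have yw : l1norm (y s - C *m z') <= (r%:R + l1norm C * X) * w.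
  apply: le_trans
    (l1normB_le (l1norm_obs s) (l1normM_le (lexx (l1norm C)) z'X)) _.
  by rewrite mulrDl lerD// ler_peMr// mulr_ge0.
have h1 : l1norm ((drift S - G *m C) *m (z - z')) <=
    filter_rate b M * l1norm (z - z').
  by apply: l1normM_le => //; apply: l1normB_le => //; exact: l1normM_le.
have h2 : l1norm ((drift S - drift S') *m z') <= e * X * w.
  by apply: le_trans (l1normM_le Ae z'X) _; rewrite ler_peMr// mulr_ge0.
have h3 := l1normM_le GG yw.
apply: le_trans (l1normD_le (l1normD_le h1 h2) h3) _.
rewrite -addrA lerD2l /filter_defect le_eqVlt; apply/orP; left.
by apply/eqP; ring.
Qed.

Definition filter_lip (b M L X : R) : R :=
  (1 + n%:R * filter_rate b M * T * expR (n%:R * filter_rate b M * T))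
  * (n%:R * (filter_defect b M L X * \int[mu]_(s in `[0, T]) obs_weight y s)).

Lemma Rintegral_mono (f : R -> R) t : 0 <= t <= T ->
  (forall s, 0 <= f s) -> mu.-integrable `[0, T] (EFin \o f) ->
  \int[mu]_(s in `[0, t]) f s <= \int[mu]_(s in `[0, T]) f s.
Proof.
move=> /andP[t0 tT] f0 fi; rewrite /Rintegral fine_le//.
- exact: (integrable_fin_num _ (integrable_itvS tT fi)).
- exact: (integrable_fin_num _ fi).
- apply: ge0_subset_integral => //.
  + exact: (measurable_int _ fi).
  + by move=> s _; rewrite lee_fin.
  + by apply: subset_itvl; rewrite bnd_simp.
Qed.

(** In integrated form, the difference of two solutions satisfies the integral
    Gronwall inequality: its defect involves [y] only through its integral. *)
Lemma filter_close b M L X e S S' P P' x x' :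
  0 <= T -> 0 <= b -> 0 <= M -> 0 <= L -> 0 <= X -> 0 <= e ->
  quad_l1_bounded b S -> quad_l1_bounded b S' -> quad_l1_close e S S' ->
  l1norm (invmx (obs_cov S) - invmx (obs_cov S')) <= b * e * b ->
  mx_cont `[0, T] P -> mx_cont `[0, T] P' ->
  filter_solution T C x0 y S P x -> filter_solution T C x0 y S' P' x' ->
  (forall t, 0 <= t <= T -> l1norm (P t) <= M) ->
  (forall t, 0 <= t <= T -> l1norm (P' t) <= M) ->
  (forall t, 0 <= t <= T -> l1norm (P t - P' t) <= L * e) ->
  (forall t, 0 <= t <= T -> l1norm (x' t) <= X) ->
  forall t, 0 <= t <= T -> l1norm (x t - x' t) <= filter_lip b M L X * e.
Proof.
move=> T0 b0 M0 L0 X0 e0 Sb Sb' Sc Qe cP cP' [cx xE] [cx' x'E] PM P'M PL x'X.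
have {}cx := mx_cont_within cx; have {}cx' := mx_cont_within cx'.
set a := filter_rate b M; set d := filter_defect b M L X.
have c0 : 0 <= l1norm C by exact: l1norm_ge0.
have a0 : 0 <= a by rewrite addr_ge0// !mulr_ge0.
have d0 : 0 <= d.
  by rewrite addr_ge0// mulr_ge0// addr_ge0// !mulr_ge0.
have wi := integrable_obs_weight hy.
have w0 s : 0 <= obs_weight y s by exact: le_trans (obs_weight_ge1 s).
pose H := \int[mu]_(s in `[0, T]) obs_weight y s.
have H0 : 0 <= H by apply: Rintegral_ge0.
pose g s := l1norm (x s - x' s).
have cg : {within `[0, T], continuous g}.
  by apply: within_l1norm; exact: mx_contB.
have gle t : 0 <= t <= T ->
    g t <= n%:R * a * \int[mu]_(s in `[0, t]) g s + n%:R * (d * H) * e.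
  move=> tT; have /andP[t0 tT'] := tT.
  have -> : n%:R * a * \int[mu]_(s in `[0, t]) g s + n%:R * (d * H) * e =
      (n * 1)%:R * (a * \int[mu]_(s in `[0, t]) g s + d * e * H).
    by rewrite muln1; ring.
  apply: l1norm_le_entries => i j; rewrite (ord1 j).
  have mxB (u v : 'cV[R]_n) : u i 0 - v i 0 = (u - v) i 0 by rewrite !mxE.
  rewrite -mxB (xE t tT) (x'E t tT).
  rewrite opprD addrACA subrr add0r.
  have fi := integrable_itvS tT' (integrable_filter_rhs hy C S i cP cx).
  have fi' := integrable_itvS tT' (integrable_filter_rhs hy C S' i cP' cx').
  have gi := integrable_itvS tT' (within_integrable cg).
  have wit := integrable_itvS tT' wi.
  rewrite -RintegralB//; have fB : mu.-integrable `[0, t] (EFin \o (fun s =>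
      filter_rhs C S (P s) (y s) (x s) i 0
      - filter_rhs C S' (P' s) (y s) (x' s) i 0)).
    exact: integrableB_fun.
  apply: le_trans (le_normr_Rintegral _ _) _ => //.
  have agi : mu.-integrable `[0, t] (EFin \o (fun s => a * g s)).
    exact: integrableZ_fun.
  have dwi : mu.-integrable `[0, t] (EFin \o (fun s => d * e * obs_weight y s)).
    exact: integrableZ_fun.
  apply: (@le_trans _ _
    (\int[mu]_(s in `[0, t]) (a * g s + d * e * obs_weight y s))).
    apply: le_Rintegral => //.
    - exact: integrable_norm_fun.
    - exact: integrableD_fun.
    move=> s /=; rewrite in_itv/= => /andP[s0 st].
    have sT : 0 <= s <= T by rewrite s0 (le_trans st).
    apply: le_trans (filter_rhs_close s (x s) b0 M0 L0 X0 e0 Sb Sb' Sc Qe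
      (PM s sT) (P'M s sT) (PL s sT) (x'X s sT)).
    by rewrite mxB; exact: entry_le_l1norm.
  rewrite RintegralD// !RintegralZl// lerD2l ler_wpM2l ?mulr_ge0//.
  exact: Rintegral_mono.
move=> t tT; have na0 : 0 <= n%:R * a by rewrite mulr_ge0.
have nd0 : 0 <= n%:R * (d * H) * e by rewrite !mulr_ge0.
have := integral_gronwall na0 nd0 cg gle tT.
by rewrite /filter_lip -/a -/d -/H mulrA.
Qed.

End FilterStability.

(** * Stability of the filter with respect to the data *)

Section Stability.
Context {R : realType} {n m r : nat}.
Implicit Types S : quad R n m r.

Lemma quad_l1_bounded_mono b b' S : b <= b' ->
  quad_l1_bounded b S -> quad_l1_bounded b' S.
Proof.
move=> bb' [h1 h2 h3 [h4 h5]].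
by split; [| | |split]; exact: le_trans bb'.
Qed.

Lemma quad_l1_bounded_ex S : exists2 b, 0 <= b & quad_l1_bounded b S.
Proof.
exists (l1norm (drift S) + l1norm (init_cov S) + l1norm (model_cov S)
  + l1norm (obs_cov S) + l1norm (invmx (obs_cov S))).
  by rewrite !addr_ge0 ?l1norm_ge0.
have := l1norm_ge0 (drift S); have := l1norm_ge0 (init_cov S).
have := l1norm_ge0 (model_cov S); have := l1norm_ge0 (obs_cov S).
have := l1norm_ge0 (invmx (obs_cov S)) => *.
by split; [| | |split]; lra.
Qed.

(** The reference solution may enter the constant through its own bounds, the
    perturbed one only through [b]. *)
Lemma filter_lipschitz (T : R) (T0 : 0 <= T) (B : 'M[R]_(n, m)) (C : 'M[R]_(r, n))
    (x0 : 'cV[R]_n) (y : R -> 'cV[R]_r) (hy : square_integrable T y)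
    S0 (P0 : R -> 'M[R]_n) (z0 : R -> 'cV[R]_n) (b : R) :
  0 <= b -> admissible S0 -> riccati_solution T B C S0 P0 ->
  filter_solution T C x0 y S0 P0 z0 ->
  exists2 c, 0 <= c & forall e S P z, 0 <= e ->
    admissible S -> quad_l1_bounded b S -> quad_l1_close e S S0 ->
    riccati_solution T B C S P -> filter_solution T C x0 y S P z ->
    forall t, 0 <= t <= T -> l1norm (z t - z0 t) <= c * e.
Proof.
move=> b0 S0a SP0 Fz0.
have [b1 b10 S0b1] := quad_l1_bounded_ex S0.
pose b' := b + b1.
have b'0 : 0 <= b' by rewrite addr_ge0.
have S0b : quad_l1_bounded b' S0.
  by apply: quad_l1_bounded_mono S0b1; rewrite lerDr.
pose M := Num.max 0 (riccati_bound T B b').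
have M0 : 0 <= M by rewrite le_max lexx.
have PM S P : admissible S -> quad_l1_bounded b' S -> riccati_solution T B C S P ->
    forall t, 0 <= t <= T -> l1norm (P t) <= M.
  move=> Sa Sb SP t tT; apply: le_trans (riccati_le T0 b'0 Sa Sb SP tT) _.
  by rewrite le_max lexx orbT.
have [X X0 z0X] := mx_cont_bounded T0 (mx_cont_within (proj1 Fz0)).
pose L := Num.max 0 (riccati_lip T B C b' M).
have L0 : 0 <= L by rewrite le_max lexx.
exists (Num.max 0 (filter_lip T C y b' M L X)); first by rewrite le_max lexx.
move=> e S P z e0 Sa Sb Sc SP Fz t tT.
have {}Sb : quad_l1_bounded b' S by apply: quad_l1_bounded_mono Sb; rewrite lerDl.
have PL s : 0 <= s <= T -> l1norm (P s - P0 s) <= L * e.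
  move=> sT; apply: le_trans (riccati_close T0 b'0 M0 e0 Sa S0a Sb S0b Sc SP SP0
    (PM _ _ Sa Sb SP) (PM _ _ S0a S0b SP0) sT) _.
  by rewrite ler_wpM2r// le_max lexx orbT.
apply: le_trans (filter_close hy T0 b'0 M0 L0 X0 e0 Sb S0b Sc
  (obs_inv_close Sa S0a Sb S0b Sc) (riccati_mx_cont SP) (riccati_mx_cont SP0)
  Fz Fz0 (PM _ _ Sa Sb SP) (PM _ _ S0a S0b SP0) PL z0X tT) _.
by rewrite ler_wpM2r// le_max lexx orbT.
Qed.

End Stability.

(** * The uncertain system *)

Section Uncertain.
Context {R : realType} {n m r : nat} {I : finType}.
Hypothesis I0 : (0 < #|I|)%N.
Variables (S : I -> quad R n m r).

Lemma expect_quad_admissible :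
  (forall s, admissible (S s)) -> admissible (expect_quad S).
Proof.
by move=> Sa; split; apply: expect_posdef => // s; case: (Sa s).
Qed.

(** Dominates the factors lost between induced and entrywise norms: [m * n] for
    an [m * n] matrix, squared for the inverse of the mean of the [Q]. *)
Definition dims : R := ((n * n)%:R + (m * m)%:R + (r * r)%:R + (r * r)%:R ^+ 2).

Lemma dims_ge : [/\ (n * n)%:R <= dims, (m * m)%:R <= dims, (r * r)%:R <= dims
  & (r * r)%:R * (r * r)%:R <= dims].
Proof.
have := ler0n R (n * n); have := ler0n R (m * m); have := ler0n R (r * r).
have := sqr_ge0 ((r * r)%:R : R); rewrite /dims -expr2 => *.
by split; lra.
Qed.

Lemma expect_quad_bounded kappa : (forall s, admissible (S s)) ->
  (forall s, quad_bounded kappa (S s)) ->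
  quad_l1_bounded (dims * `|kappa|) (expect_quad S).
Proof.
move=> Sa Sb; have [dn dm dr drr] := dims_ge.
have k s : [/\ opnorm (drift (S s)) <= `|kappa|,
    opnorm (init_cov (S s)) <= `|kappa|, opnorm (model_cov (S s)) <= `|kappa|
    & opnorm (obs_cov (S s)) <= `|kappa| /\
      opnorm (invmx (obs_cov (S s))) <= `|kappa|].
  have [? [? _] [? _] [? ?]] := Sb s.
  by split; [| | |split]; apply: le_trans (ler_norm _).
split; [| | |split].
1-3: by apply: le_trans (l1norm_expect_le I0 (c := `|kappa|) _) _;
  [move=> s; have [] := k s | rewrite ler_wpM2r].
- apply: le_trans (l1norm_expect_le I0 (c := `|kappa|) _) _.
    by move=> s; have [_ _ _ []] := k s.
  by rewrite ler_wpM2r.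
- apply: le_trans (l1norm_invmx_expect I0 (normr_ge0 kappa) _ _) _.
  + by move=> s; have [] := Sa s.
  + by move=> s; have [_ _ _ []] := k s.
  + by rewrite mulrA ler_wpM2r.
Qed.

Lemma expect_quad_close (S0 : quad R n m r) :
  quad_l1_close (dims * expect (fun s => quad_norm1 (S s - S0) : R^o))
    (expect_quad S) S0.
Proof.
have [dn dm dr drr] := dims_ge.
set E := expect _.
have q0 s : 0 <= quad_norm1 (S s - S0) by rewrite !addr_ge0// opnorm_ge0.
have E0 : 0 <= E.
  by rewrite /E /expect /GRing.scale/= mulr_ge0 ?invr_ge0// sumr_ge0.
have comp s : [/\ opnorm (drift (S s) - drift S0) <= quad_norm1 (S s - S0),
    opnorm (init_cov (S s) - init_cov S0) <= quad_norm1 (S s - S0),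
    opnorm (model_cov (S s) - model_cov S0) <= quad_norm1 (S s - S0)
    & opnorm (obs_cov (S s) - obs_cov S0) <= quad_norm1 (S s - S0)].
  rewrite /quad_norm1 -[drift (S s) - _]/(drift (S s - S0)).
  rewrite -[init_cov (S s) - _]/(init_cov (S s - S0)).
  rewrite -[model_cov (S s) - _]/(model_cov (S s - S0)).
  rewrite -[obs_cov (S s) - _]/(obs_cov (S s - S0)).
  have := opnorm_ge0 (drift (S s - S0)).
  have := opnorm_ge0 (init_cov (S s - S0)).
  have := opnorm_ge0 (model_cov (S s - S0)).
  have := opnorm_ge0 (obs_cov (S s - S0)).
  move: (opnorm (drift _)) (opnorm (init_cov _)) (opnorm (model_cov _))
    (opnorm (obs_cov _)) => a b c d *.
  by split; lra.
split; apply: le_trans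
    (l1norm_expect_sub I0 (q := fun s => quad_norm1 (S s - S0)) _) _;
  by [move=> s; have [] := comp s | rewrite ler_wpM2r].
Qed.

End Uncertain.

Lemma wnorm_le_l1norm (R : realType) (n : nat) (K : 'M[R]_n) (v : 'cV[R]_n) c :
  l1norm K <= c ^+ 2 -> 0 <= c -> wnorm K v <= c * l1norm v.
Proof.
move=> Kc c0; have -> : c * l1norm v = Num.sqrt (c ^+ 2 * l1norm v ^+ 2).
  by rewrite -exprMn sqrtr_sqr ger0_norm// mulr_ge0// l1norm_ge0.
rewrite /wnorm ler_wsqrtr//; apply: le_trans (ler_norm _) _.
apply: le_trans (norm_bform_l1norm_le _ _) _.
by rewrite ler_wpM2r// exprn_ge0// l1norm_ge0.
Qed.

(* The constant is chosen after T, B, C, x0, y, the quadruple S0 of the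
   nominal parameter (with its Pi and xhat) and a bound kappa on the matrices
   involved, but before the parameter set, hence before N. *)
Theorem proposition4p7 (R : realType) (T : R) (hT : 0 < T) (n m r : nat)
    (B : 'M[R]_(n, m)) (C : 'M[R]_(r, n)) (x0 : 'cV[R]_n)
    (y : R -> 'cV[R]_r) (hy : square_integrable T y)
    (S0 : quad R n m r) (hS0 : admissible S0)
    (Pi0 : R -> 'M[R]_n) (hPi0 : riccati_solution T B C S0 Pi0)
    (xhat0 : R -> 'cV[R]_n) (hxhat0 : filter_solution T C x0 y S0 Pi0 xhat0)
    (kappa : R) :
  exists2 cE : R, 0 < cE &
    forall (dA dG dR dQ : nat)
      (SigmaA : {fset 'rV[R]_dA}) (SigmaG : {fset 'rV[R]_dG})
      (SigmaR : {fset 'rV[R]_dR}) (SigmaQ : {fset 'rV[R]_dQ})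
      (A : SigmaA -> 'M[R]_n) (Gam : SigmaG -> 'M[R]_n)
      (Rm : SigmaR -> 'M[R]_m) (Q : SigmaQ -> 'M[R]_r),
    let S := param_quad A Gam Rm Q in
    (forall s, admissible (S s)) ->
    (forall s, quad_bounded kappa (S s)) ->
    forall sbar : SigmaA * SigmaG * SigmaR * SigmaQ,
    S sbar = S0 ->
    forall (PiE : R -> 'M[R]_n) (xhatE : R -> 'cV[R]_n),
    riccati_solution T B C (expect_quad S) PiE ->
    filter_solution T C x0 y (expect_quad S) PiE xhatE ->
    forall t : R, 0 <= t <= T ->
      wnorm (invmx (Pi0 t)) (xhatE t - xhat0 t)
        <= cE * expect (fun s => quad_norm1 (S s - S sbar) : R^o).
Proof.
have T0 : 0 <= T by exact: ltW.
have dk0 : 0 <= @dims R n m r * `|kappa|.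
  by rewrite mulr_ge0// !addr_ge0// exprn_ge0.
have [c c0 hc] := filter_lipschitz T0 hy dk0 hS0 hPi0 hxhat0.
have [p p0 Pp] := riccati_coercive T0 hS0 hPi0.
(* A bound for the inverse of [Pi0]; being at least 1, it is at most its square,
   which avoids taking its square root. *)
pose q := (n * n)%:R * p + 1.
have q1 : 1 <= q by rewrite lerDr mulr_ge0.
have q0 : 0 <= q by exact: le_trans q1.
exists (q * (c * @dims R n m r) + 1).
  by rewrite ltr_wpDl// !mulr_ge0// !addr_ge0// exprn_ge0.
move=> dA dG dR dQ SigmaA SigmaG SigmaR SigmaQ A Gam Rm Q S Sa Sb sbar SbarE.
move=> PiE xhatE hPiE hxhatE t tT; rewrite SbarE; set E := expect _.
have I0 : (0 < #|{: SigmaA * SigmaG * SigmaR * SigmaQ}|)%N.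
  by apply/card_gt0P; exists sbar.
have E0 : 0 <= E.
  rewrite /E /expect /GRing.scale/= mulr_ge0 ?invr_ge0// sumr_ge0// => s _.
  by rewrite !addr_ge0// opnorm_ge0.
have close := expect_quad_close I0 S S0.
have dE0 : 0 <= @dims R n m r * E.
  by rewrite mulr_ge0// !addr_ge0// exprn_ge0.
have := hc _ _ _ _ dE0 (expect_quad_admissible I0 Sa)
  (expect_quad_bounded I0 Sa Sb) close hPiE hxhatE t tT.
move=> dx; have Kq : l1norm (invmx (Pi0 t)) <= q ^+ 2.
  apply: le_trans (coercive_invmx p0 (Pp t tT)) _.
  by apply: (@le_trans _ _ q); [rewrite lerDl|rewrite expr2 ler_peMl].
apply: le_trans (wnorm_le_l1norm _ Kq q0) _.
apply: (@le_trans _ _ (q * (c * (@dims R n m r * E)))).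
  by rewrite ler_wpM2l.
have -> : q * (c * (@dims R n m r * E)) = q * (c * @dims R n m r) * E.
  by rewrite !mulrA.
by rewrite ler_wpM2r// lerDl.
Qed.
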